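(* Let $B$ be a unital $C^*$-algebra, $A$ a sub-$C^*$-algebra of $B$ (containing the unit of $B$), $I$ an isocone of $A$ and $K$ a closed two-sided ideal of $B$. Then $\overline{I+\mathrm{Re}(K)}$ is an isocone of the $C^*$-algebra $A+K$.
   Context: All $C^*$-algebras have a unit, and sub-$C^*$-algebras contain the unit. For a $C^*$-algebra $A$ with unit $1$, $\mathrm{Re}(A)$ is the set of self-adjoint elements; $\mathrm{Re}(K)$ is the set of self-adjoint elements of $K$. $I(\mathbb{R})$ is the set of continuous non-decreasing functions $\mathbb{R}\to\mathbb{R}$. An isocone of $A$ is a subset $I\subset\mathrm{Re}(A)$ such that: (1) $x\cdot 1\in I$ for all $x\in\mathbb{R}$; (2) $b+b'\in I$ for all $b,b'\in I$; (3) $\phi(b)\in I$ for all $b\in I$ and $\phi\in I(\mathbb{R})$ (continuous functional calculus); (4) $I$ is norm-closed; (5) $\overline{I-I}=\mathrm{Re}(A)$, where $I-I=\{b-b':b,b'\in I\}$. The bar denotes norm closure. That $A+K=\{a+k: a\in A,k\in K\}$ is a $C^*$-algebra is a classical fact. *)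

(* Defs.v *)
From HB Require Import structures.
From mathcomp Require Import all_boot all_order all_algebra.
From mathcomp Require Import all_classical all_reals all_analysis.
From mathcomp Require Import complex.

Set Implicit Arguments.
Unset Strict Implicit.
Unset Printing Implicit Defensive.

Import Order.TTheory GRing.Theory Num.Theory.
Import numFieldNormedType.Exports.

Local Open Scope classical_set_scope.
Local Open Scope ring_scope.
Local Open Scope complex_scope.

(* The usual topology of the field R[i], given by its norm. *)
HB.instance Definition _ (R : realType) :=
  NormedModule.copy R[i] R[i]^o.

(* Unital complex C*-algebras. The norm of a normed R[i]-module takes its
   values in R[i] (in fact in its nonnegative reals). The multiplication is part
   of the mixin because the ring and the normed module hierarchies have no join
   to inherit from; the ring structure is recovered as an instance below. It is
   a pzRingType, so that the zero algebra is allowed. *)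
HB.mixin Record isCstarAlgebra (R : realType) B
    of CompleteNormedModule R[i] B := {
  cstar_one : B ;
  cstar_mul : B -> B -> B ;
  star : B -> B ;
  cstar_mulA : associative cstar_mul ;
  cstar_mul1l : left_id cstar_one cstar_mul ;
  cstar_mul1r : right_id cstar_one cstar_mul ;
  cstar_mulDl : left_distributive cstar_mul +%R ;
  cstar_mulDr : right_distributive cstar_mul +%R ;
  cstar_scalerAl : forall (c : R[i]) (x y : B),
    c *: cstar_mul x y = cstar_mul (c *: x) y ;
  cstar_scalerAr : forall (c : R[i]) (x y : B),
    c *: cstar_mul x y = cstar_mul x (c *: y) ;
  cstar_normM : forall x y : B, `|cstar_mul x y| <= `|x| * `|y| ;
  starK : involutive star ;
  starD : {morph star : x y / x + y} ;
  starZ : forall (c : R[i]) (x : B), star (c *: x) = c^* *: star x ;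
  starM : forall x y : B, star (cstar_mul x y) = cstar_mul (star y) (star x) ;
  norm_starM : forall x : B, `|cstar_mul (star x) x| = `|x| ^+ 2
}.

#[short(type="cstarAlgType")]
HB.structure Definition CstarAlgebra (R : realType) :=
  {B of CompleteNormedModule R[i] B & isCstarAlgebra R B}.

#[non_forgetful_inheritance]
HB.instance Definition _ (R : realType) (B : cstarAlgType R) :=
  GRing.Zmodule_isPzRing.Build (CstarAlgebra.sort B)
    cstar_mulA cstar_mul1l cstar_mul1r cstar_mulDl cstar_mulDr.

Section Cstar.
Variables (R : realType) (B : cstarAlgType R).
Implicit Types (A I K : set B) (a b : B) (f g : R[i] -> R[i]).

Record sub_cstar A : Prop := SubCstar {
  sub_cstar_closed : closed A ;
  sub_cstar1 : A 1 ;
  sub_cstarD : forall x y, A x -> A y -> A (x + y) ;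
  sub_cstarM : forall x y, A x -> A y -> A (x * y) ;
  sub_cstarZ : forall (c : R[i]) x, A x -> A (c *: x) ;
  sub_cstar_star : forall x, A x -> A (star x)
}.

(* Stability under scalars follows from the unit of B. *)
Record closed_ideal K : Prop := ClosedIdeal {
  closed_ideal_closed : closed K ;
  closed_ideal0 : K 0 ;
  closed_idealD : forall x y, K x -> K y -> K (x + y) ;
  closed_idealMl : forall b x, K x -> K (b * x) ;
  closed_idealMr : forall b x, K x -> K (x * b)
}.

Definition selfadj A : set B := [set a | A a /\ star a = a].

Definition set_add (X Y : set B) : set B := [set x + y | x in X & y in Y].

Definition set_sub (X Y : set B) : set B := [set x - y | x in X & y in Y].

Definition spectrum A a : set R[i] :=
  [set z | ~ exists2 b, A b & (a - z *: (1 : B)) * b = 1 /\ b * (a - z *: (1 : B)) = 1].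

(* Phi is the continuous functional calculus of a in A: the isometric unital
   *-morphism from C(spectrum A a) to A sending the identity to a. Elements of
   C(spectrum A a) are represented by functions on R[i] that are continuous on
   the spectrum; by cfc_isometry, Phi f depends only on the restriction of f to
   the spectrum. That field says that the norm of Phi f is the sup norm
   of f on the spectrum, in a form that also covers an empty spectrum. *)
Record is_cfc A a (Phi : (R[i] -> R[i]) -> B) : Prop := IsCfc {
  cfc_in : forall f, {within spectrum A a, continuous f} -> A (Phi f) ;
  cfc_id : Phi (fun z => z) = a ;
  cfc1 : Phi (fun=> 1) = 1 ;
  cfcD : forall f g, {within spectrum A a, continuous f} ->
    {within spectrum A a, continuous g} ->
    Phi (fun z => f z + g z) = Phi f + Phi g ;
  cfcM : forall f g, {within spectrum A a, continuous f} ->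
    {within spectrum A a, continuous g} ->
    Phi (fun z => f z * g z) = Phi f * Phi g ;
  cfcZ : forall (c : R[i]) f, {within spectrum A a, continuous f} ->
    Phi (fun z => c * f z) = c *: Phi f ;
  cfc_star : forall f, {within spectrum A a, continuous f} ->
    Phi (fun z => (f z)^*) = star (Phi f) ;
  cfc_isometry : forall f (M : R[i]), {within spectrum A a, continuous f} ->
    0 <= M ->
    (`|Phi f| <= M <-> forall z, spectrum A a z -> `|f z| <= M)
}.

(* f(a) in A; the value 0 is a dummy, never met when a is a normal element of a
   sub-C*-algebra A and f is continuous on its spectrum. *)
Definition cfc A a f : B :=
  xget 0 [set c | exists2 Phi, is_cfc A a Phi & Phi f = c].

(* phi(b) for phi : R -> R and b self-adjoint, whose spectrum is real. *)
Definition real_cfc A b (phi : R -> R) : B :=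
  cfc A b (fun z => (phi (complex.Re z))%:C).

Record isocone A I : Prop := Isocone {
  isocone_selfadj : I `<=` selfadj A ;
  isocone_cst : forall x : R, I (x%:C *: (1 : B)) ;
  isoconeD : forall b b', I b -> I b' -> I (b + b') ;
  isocone_cfc : forall (phi : R -> R) b, continuous phi ->
    {homo phi : x y / x <= y} -> I b -> I (real_cfc A b phi) ;
  isocone_closed : closed I ;
  isocone_dense : closure (set_sub I I) = selfadj A
}.

End Cstar.

(* Main.v *)
(* The heart of the matter is that phi(i + k) - phi(i) lies in Re(K) for i in I
   and k in Re(K): this is clear for a polynomial phi, and passes to continuous
   phi by uniform approximation on a bounded interval containing both spectra.
   Hence phi maps I + Re(K) into itself, and its closure into itself.

   The continuous functional calculus rests on the equality of the norm of a
   polynomial p(a), a selfadjoint, with the supremum of |p| on the spectrum of a.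
   Since p(a)^* p(a) is selfadjoint and p factors over the complex numbers, it
   suffices to show that 1 - h^2 is not invertible when h is selfadjoint of norm
   1. If it had an inverse c, then with t = max(|c|, 1) both 1 - h^2 and 1 - c/t
   would have selfadjoint square roots s and r commuting with h and with each
   other, so that h^2 + (s r)^2 = 1 - 1/t, whence |h|^2 <= 1 - 1/t < 1.

   For A + K to be closed it is enough that every a in A with |a + k| <= d is
   within 2 d of A :&: K. For a and k selfadjoint take g(a) with g(t) the
   difference of t and its truncation to [-d, d]: g(a) is congruent modulo K to
   g(a + k) = 0. *)

Require Import Defs.
From mathcomp Require Import all_boot all_order all_algebra.
From mathcomp Require Import all_classical all_reals all_analysis.
From mathcomp Require Import complex.
From mathcomp Require Import ring lra.

Import Order.TTheory GRing.Theory Num.Theory.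
Import numFieldNormedType.Exports.
Local Open Scope classical_set_scope.
Local Open Scope ring_scope.
Local Open Scope complex_scope.

(** * Weierstrass approximation *)

Section Weierstrass.
Variable R : realType.

(* Expectation of g(S_n), S_n a sum of n Bernoulli variables of parameter 'X:
   the Bernstein polynomial of g. *)
Fixpoint bernstein (n : nat) (g : nat -> R) : {poly R} :=
  if n is n'.+1 then
    (1 - 'X) * bernstein n' g + 'X * bernstein n' (fun k => g k.+1)
  else (g 0%N)%:P.

Lemma bernstein_cst n (c : R) : bernstein n (fun=> c) = c%:P.
Proof. by elim: n => //= n ->; ring. Qed.

Lemma bernsteinD n g h :
  bernstein n (fun k => g k + h k) = bernstein n g + bernstein n h.
Proof. by elim: n g h => [|n IH] g h /=; rewrite ?polyCD// !IH; ring. Qed.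

Lemma bernsteinZ n c g :
  bernstein n (fun k => c * g k) = c%:P * bernstein n g.
Proof. by elim: n g => [|n IH] g /=; rewrite ?polyCM// !IH; ring. Qed.

Lemma bernstein_ge0 n g x : 0 <= x <= 1 ->
  (forall k, (k <= n)%N -> 0 <= g k) -> 0 <= (bernstein n g).[x].
Proof.
move=> /andP[x0 x1]; elim: n g => [|n IH] g g0 /=; first by rewrite hornerC g0.
rewrite !hornerE addr_ge0// mulr_ge0 ?subr_ge0 ?IH// => k kn; apply: g0 => //.
exact: leqW.
Qed.

(** The second moment of a binomial variable about [c] is its variance plus the squared distance
    from its mean to [c]. The induction shifts [c] by one, so [c] is left free. *)
Lemma bernstein_variance n (c x : R) :
  (bernstein n (fun k => (k%:R - c) ^+ 2)).[x] =
  n%:R * x * (1 - x) + (n%:R * x - c) ^+ 2.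
Proof.
elim: n c => [|n IH] c /=; first by rewrite hornerC; ring.
under [in X in _ + X]eq_fun => k do rewrite -natr1 -addrA -[1 - c]opprB.
rewrite !hornerE !IH -natr1; ring.
Qed.

(** Near the diagonal continuity gives [e]; away from it the square is bounded below, and a large
    [C] lifts it above [2 * F], with [F] a bound of [|f|]. Bernstein polynomials have an explicit
    second moment, which suits this form. *)
Lemma quadratic_modulus (f : R -> R) (e : R) : 0 < e -> continuous f ->
  exists2 C, 0 <= C & forall x v : R, 0 <= x <= 1 -> 0 <= v <= 1 ->
    `|f x - f v| <= e + C * (x - v) ^+ 2.
Proof.
move=> e0 cf.
have cpt : compact (`[0, 1]%classic : set R) by exact: segment_compact.
have [F F0 Fb] : exists2 F : R, 0 < F & forall x, 0 <= x <= 1 -> `|f x| <= F.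
  have : bounded_set [set f x | x in `[0, 1]%classic].
    apply: compact_bounded; apply: continuous_compact => //.
    exact: continuous_subspaceT.
  move=> /ex_strict_bound_gt0 [F F0 Fb]; exists F => // x x01.
  by apply/ltW/Fb; exists x => //=; rewrite in_itv.
(* Compactness as near covering: a [C] that works around each point yields one for the whole
   interval. *)
have nc := iffLR (compact_near_coveringP _) cpt.
have : \forall C \near +oo, `[0, 1]%classic `<=` [set x : R |
    x \in `[0, 1] -> forall v, 0 <= v <= 1 -> `|f x - f v| <= e + C * (x - v) ^+ 2].
  apply: nc => x _.
  have e2 : 0 < e / 2 by lra.
  have /cvgrPdist_lt /(_ _ e2) /nbhs_ballP [d /= d0 dP] := cf x.
  have d20 : 0 < d / 2 by lra.
  near=> x' C => /=; rewrite in_itv /= => x'01 v v01.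
    have dx : `|x - x'| < d / 2.
      by near: x'; apply/nbhs_ballP; exists (d / 2).
    have C0 : 0 <= C by near: C; exact: nbhs_pinfty_ge.
    have [xv|xv] := ltP `|x' - v| (d / 2).
      have xv' : `|x - v| < d.
        rewrite -(subrK x' x) -addrA; apply: le_lt_trans (ler_normD _ _) _; lra.
      have h1 : `|f x - f x'| < e / 2.
        by apply: dP; rewrite /ball /= (lt_trans dx)//; lra.
      have h2 : `|f x - f v| < e / 2 by apply: dP.
      have -> : f x' - f v = (f x - f v) - (f x - f x') by ring.
      apply: le_trans (ler_normB _ _) _; apply: (@le_trans _ _ (e / 2 + e / 2)).
        by rewrite lerD// ltW.
      by rewrite -splitr lerDl mulr_ge0 ?sqr_ge0.
    apply: (@le_trans _ _ (2 * F)).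
      apply: le_trans (ler_normB _ _) _.
      by rewrite mulr_natl mulr2n lerD// Fb.
    have CF : 2 * F / (d / 2) ^+ 2 <= C by near: C; apply: nbhs_pinfty_ge; rewrite num_real.
    have : 2 * F <= C * (d / 2) ^+ 2 by rewrite -ler_pdivrMr// exprn_gt0.
    have : (d / 2) ^+ 2 <= (x' - v) ^+ 2.
      by rewrite -[leRHS]real_normK ?num_real// lerXn2r ?nnegrE ?(ltW d20).
    move=> h1 h2; apply: (le_trans h2); apply: (le_trans (ler_wpM2l C0 h1)).
    by rewrite lerDr ltW.
case=> C0 [C0r CP]; exists (`|C0| + 1); first by rewrite addr_ge0.
move=> x v x01 v01; apply: CP => //=; rewrite ?in_itv//.
by rewrite (le_lt_trans (ler_norm _))// ltrDl.
Unshelve. all: by end_near.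
Qed.

(** The operator [bernstein n] is linear and positive, so it preserves the bound of
    [quadratic_modulus]; the variance turns the quadratic term into [C / n * (x * (1 - x))]. *)
Lemma weierstrass01 (f : R -> R) (e : R) : 0 < e -> continuous f ->
  exists p : {poly R}, forall x, 0 <= x <= 1 -> `|f x - p.[x]| <= e.
Proof.
move=> e0 cf; have [C C0 CP] := @quadratic_modulus f (e / 2) ltac:(lra) cf.
have [n n0 nC] : exists2 n : nat, (0 < n)%N & C <= e / 2 * n%:R.
  exists (Num.truncn (C / (e / 2))).+1 => //.
  by rewrite mulrC -ler_pdivrMr; [exact/ltW/truncnS_gt|lra].
have n0R : 0 < n%:R :> R by rewrite ltr0n.
exists (bernstein n (fun k => f (k%:R / n%:R))) => x x01.
have key k : (k <= n)%N ->
    `|f x - f (k%:R / n%:R)| <= e / 2 + C / n%:R ^+ 2 * (k%:R - n%:R * x) ^+ 2.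
  move=> kn; apply: le_trans (CP _ _ x01 _) _.
    by rewrite divr_ge0//= ler_pdivrMr// mul1r ler_nat.
  suff -> : C * (x - k%:R / n%:R) ^+ 2 = C / n%:R ^+ 2 * (k%:R - n%:R * x) ^+ 2 by [].
  by field; rewrite gt_eqF.
have bnd : (bernstein n (fun k => e / 2 + C / n%:R ^+ 2 *
    (k%:R - n%:R * x) ^+ 2)).[x] <= e.
  rewrite bernsteinD bernstein_cst bernsteinZ !hornerE bernstein_variance.
  rewrite subrr expr0n addr0.
  have -> : C / n%:R ^+ 2 * (n%:R * x * (1 - x)) = C / n%:R * (x * (1 - x)).
    by field; rewrite gt_eqF.
  have : C / n%:R <= e / 2 by rewrite ler_pdivrMr.
  have : 0 <= C / n%:R by rewrite divr_ge0// ltW.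
  move: x01 => /andP[x0 x1]; have : x * (1 - x) <= 1 by nra.
  have : 0 <= x * (1 - x) by nra.
  nra.
set g := (fun k => e / 2 + _ * _) in bnd key.
(* The cases [s = 1] and [s = -1] give the two sides of the absolute value, each by positivity of
   the operator. *)
have lin (s : R) : `|s| <= 1 -> 0 <= (bernstein n g).[x] +
    (s * f x + - s * (bernstein n (fun k => f (k%:R / n%:R))).[x]).
  move=> s1; have <- : (bernstein n (fun k =>
      g k + (s * f x + - s * f (k%:R / n%:R)))).[x] =
      (bernstein n g).[x] +
      (s * f x + - s * (bernstein n (fun k => f (k%:R / n%:R))).[x]).
    by rewrite (bernsteinD n g) (bernsteinD n (fun=> s * f x)) bernstein_cst
      bernsteinZ !hornerE.
  apply: bernstein_ge0 => // k kn; have := key k kn.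
  have : `|s * (f x - f (k%:R / n%:R))| <= `|f x - f (k%:R / n%:R)|.
    by rewrite normrM ler_piMl.
  move=> h1 h2; have := le_trans h1 h2; rewrite -/(g k) ler_norml => /andP[h3 _].
  by rewrite mulNr -mulrBr -lerBlDl sub0r.
have := lin 1; have := lin (-1); rewrite normrN normr1 lexx => /(_ isT) h1 /(_ isT) h2.
by rewrite ler_norml; apply/andP; split; lra.
Qed.

Lemma weierstrass (f : R -> R) (M e : R) : 0 < e -> continuous f ->
  exists p : {poly R}, forall x, `|x| <= M -> `|f x - p.[x]| <= e.
Proof.
move=> e0 cf; have [M0|M0] := ltP M 0.
  by exists 0 => x /le_lt_trans/(_ M0); rewrite normr_lt0.
have [N N0 MN] : exists2 N, 0 < N & M <= N by exists (M + 1); lra.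
have [|p pP] := @weierstrass01 (fun t => f (2 * N * t - N)) e e0.
  move=> t; apply: continuous_comp; last exact: cf.
  by apply: cvgB; [apply: cvgM; [exact: cvg_cst|exact: cvg_id]|exact: cvg_cst].
(* Affine change of variable from [[-N, N]] to [[0, 1]]. *)
exists (p \Po ((2 * N)^-1 *: ('X + N%:P))) => x xM; rewrite horner_comp !hornerE.
have := pP ((2 * N)^-1 * (x + N)); rewrite mulVKf ?addrK; last by rewrite mulf_neq0// gt_eqF.
apply; move: xM; rewrite ler_norml => /andP[xM1 xM2].
rewrite mulrC divr_ge0 ?ler_pdivrMr ?mul1r; lra.
Qed.
End Weierstrass.

(** * Real-valued norms *)

Section Norm.
Context {R : realType}.

(** The norm of [V] has values in [R[i]]; its real part loses nothing and lives in the ordered field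
    [R]. *)
Definition nrm {V : normedModType R[i]} (x : V) : R := complex.Re `|x|.

Section NormedModule.
Context {V : normedModType R[i]}.
Implicit Types (x y : V) (X : set V).

Lemma nrmE x : `|x| = (nrm x)%:C.
Proof.
by have := normr_ge0 x; rewrite /nrm; case: `|x| => a b; rewrite lecE /= => /andP[/eqP ->].
Qed.

Lemma nrm_ge0 x : 0 <= nrm x.
Proof. by rewrite -ler0c -nrmE. Qed.

Lemma nrm0 : nrm (0 : V) = 0.
Proof. by rewrite /nrm normr0. Qed.

Lemma nrm_eq0 x : nrm x = 0 -> x = 0.
Proof. by move=> x0; apply/eqP; rewrite -normr_eq0 nrmE x0. Qed.

Lemma nrmN x : nrm (- x) = nrm x.
Proof. by rewrite /nrm normrN. Qed.

Lemma nrmBC x y : nrm (x - y) = nrm (y - x).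
Proof. by rewrite -nrmN opprB. Qed.

Lemma nrmD x y : nrm (x + y) <= nrm x + nrm y.
Proof. by rewrite -lecR rmorphD /= -!nrmE ler_normD. Qed.

Lemma nrmB x y : nrm (x - y) <= nrm x + nrm y.
Proof. by rewrite -(nrmN y) nrmD. Qed.

Lemma nrm_triangle y x z : nrm (x - z) <= nrm (x - y) + nrm (y - z).
Proof. by rewrite -[x - z](subrKA y) nrmD. Qed.

End NormedModule.

Lemma nrmMc (c d : R[i]) : nrm (c * d) = nrm c * nrm d.
Proof. by apply: complexI; rewrite -nrmE normrM rmorphM /= -!nrmE. Qed.

Lemma nrmc1 : nrm (1 : R[i]) = 1.
Proof. by rewrite /nrm normr1. Qed.

Lemma nrm_real (r : R) : nrm (r%:C : R[i]) = `|r|.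
Proof. by rewrite /nrm normc_def /= expr0n addr0 sqrtr_sqr. Qed.

Section Scaling.
Context {V : normedModType R[i]}.
Implicit Types (x y : V) (X : set V).

Lemma nrmZ (c : R[i]) x : nrm (c *: x) = nrm c * nrm x.
Proof. by apply: complexI; rewrite -nrmE normrZ rmorphM /= -!nrmE. Qed.

Lemma nrmZr (c : R) x : nrm (c%:C *: x) = `|c| * nrm x.
Proof. by rewrite nrmZ nrm_real. Qed.

Lemma closureP X x :
  closure X x <-> forall e : R, 0 < e -> exists2 y, X y & nrm (x - y) < e.
Proof.
split=> [clX e e0|H U /nbhs_ballP [e /= e0 eU]].
  have [|y [Xy xy]] := clX (ball x e%:C).
    by apply/nbhs_ballP; exists e%:C => //=; rewrite ltcR.
  by exists y => //; move: xy; rewrite -ball_normE /ball_ /= nrmE ltcR.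
have er : e = (complex.Re e)%:C by rewrite RRe_real// gtr0_real.
have [|y Xy xy] := H (complex.Re e); first by rewrite -ltcR -er.
by exists y; split=> //; apply: eU; rewrite -ball_normE /ball_ /= nrmE er ltcR.
Qed.

Lemma closedP X : closed X <->
  forall x, (forall e : R, 0 < e -> exists2 y, X y & nrm (x - y) < e) -> X x.
Proof.
split=> [cX x H|H x /closureP]; last exact: H.
by apply: cX; apply/closureP.
Qed.

End Scaling.

(** Telescoping bounds the oscillation of [u] by that of the bounded nondecreasing [t], so [u] is
    Cauchy. Every limit constructed in [B] below is obtained this way. *)
Lemma dominated_increments_cvg (V : completeNormedModType R[i]) (u : nat -> V)
    (t : nat -> R) (M : R) : (forall n, t n <= M) ->
  (forall n, nrm (u n.+1 - u n) <= t n.+1 - t n) ->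
  exists l, forall e : R, 0 < e -> exists N, forall n, (N <= n)%N ->
    nrm (l - u n) < e.
Proof.
move=> tM ut.
have tnd : nondecreasing_seq t.
  apply/nondecreasing_seqP => n; rewrite -subr_ge0; apply: le_trans (ut n).
  exact: nrm_ge0.
have utk n k : nrm (u (n + k)%N - u n) <= t (n + k)%N - t n.
  elim: k => [|k IH]; first by rewrite addn0 !subrr nrm0.
  rewrite addnS; apply: le_trans (nrm_triangle (u (n + k)%N) _ _) _.
  have := ut (n + k)%N; lra.
have tcvg : cvgn t.
  apply: nondecreasing_is_cvgn => //; exists M => _ [n _ <-]; exact: tM.
have ucauchy : cauchy (u @ \oo).
  apply/cauchy_ballP => e e0; near_simpl.
  have er : e = (complex.Re e)%:C by rewrite RRe_real// gtr0_real.
  have re0 : 0 < complex.Re e by rewrite -ltcR -er.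
  have e20 : 0 < complex.Re e / 2 by lra.
  have [N _ NP] := iffLR (cvgrPdist_lt _ _) tcvg _ e20.
  have uN n : (N <= n)%N -> nrm (u n - u N) < complex.Re e / 2.
    move=> Nn; rewrite -(subnKC Nn); apply: le_lt_trans (utk _ _) _.
    have h1 : t (N + (n - N))%N <= limn t by apply: nondecreasing_cvgn_le.
    have := NP N (leqnn N) => /(le_lt_trans (ler_norm _)); lra.
  exists ([set n | (N <= n)%N], [set n | (N <= n)%N]) => /=.
    by split; exists N.
  move=> [m n] [/= Nm Nn]; rewrite -ball_normE /ball_ /= nrmE er ltcR.
  apply: le_lt_trans (nrm_triangle (u N) _ _) _; rewrite (nrmBC (u N)).
  have := uN _ Nm; have := uN _ Nn; lra.
have /cvg_ex [l lP] : cvg (u @ \oo) by apply/cauchy_cvgP.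
exists l => e e0; have e0' : 0 < e%:C by rewrite ltcR.
have [N _ NP] := iffLR (cvgrPdist_lt _ _) lP _ e0'; exists N => n Nn.
by have := NP n Nn; rewrite /= nrmE ltcR.
Qed.

End Norm.

(** * Elementary consequences of the C*-identity *)

Section Cstar.
Context {R : realType} {B : cstarAlgType R}.
Implicit Types (x y z : B) (c d : R[i]) (A K : set B).

Lemma nrmM x y : nrm (x * y) <= nrm x * nrm y.
Proof. by rewrite -lecR rmorphM /= -!nrmE; exact: cstar_normM. Qed.

Lemma nrm_starM x : nrm (star x * x) = nrm x ^+ 2.
Proof. by apply: complexI; rewrite rmorphXn /= -!nrmE; exact: norm_starM. Qed.

Lemma cscalerAl c x y : c *: (x * y) = (c *: x) * y.
Proof. exact: cstar_scalerAl. Qed.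

Lemma cscalerAr c x y : c *: (x * y) = x * (c *: y).
Proof. exact: cstar_scalerAr. Qed.

Lemma star_mul x y : star (x * y) = star y * star x.
Proof. exact: starM. Qed.

Lemma star1 : star (1 : B) = 1.
Proof. by rewrite -[LHS]mulr1 -[1 in X in _ * X](starK (1 : B)) -star_mul mulr1 starK. Qed.

Lemma star0 : star (0 : B) = 0.
Proof. by apply: (addrI (star 0)); rewrite -starD !addr0. Qed.

Lemma starN x : star (- x) = - star x.
Proof. by apply: (addrI (star x)); rewrite -starD !subrr star0. Qed.

Lemma starB x y : star (x - y) = star x - star y.
Proof. by rewrite starD starN. Qed.

Lemma starZc c x : star (c *: x) = conjc c *: star x.
Proof. exact: starZ. Qed.

Lemma starZr (r : R) x : star (r%:C *: x) = r%:C *: star x.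
Proof. by rewrite starZc conjc_real. Qed.

(** Dividing [|y|^2 = |star y * y| <= |star y| * |y|] by [|y|] gives one inequality; the other is
    the same one at [star y]. *)
Lemma nrm_star x : nrm (star x) = nrm x.
Proof.
suff le y : nrm y <= nrm (star y).
  by apply/le_anti; rewrite le andbT -{2}(starK x) le.
have [->|y0] := eqVneq (nrm y) 0; first exact: nrm_ge0.
have y0' : 0 < nrm y by rewrite lt_neqAle eq_sym y0 nrm_ge0.
by rewrite -(ler_pM2r y0') -expr2 -nrm_starM nrmM.
Qed.

Lemma nrm_sqr x : star x = x -> nrm (x ^+ 2) = nrm x ^+ 2.
Proof. by move=> sx; rewrite -nrm_starM sx expr2. Qed.

(** Equality fails in the zero algebra, where the unit has norm 0. *)
Lemma nrm1_le1 : nrm (1 : B) <= 1.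
Proof.
have := @nrm_starM 1; rewrite star1 mulr1 => h.
have := nrm_ge0 (1 : B); nra.
Qed.

Lemma nrmX x n : nrm (x ^+ n) <= nrm x ^+ n.
Proof.
elim: n => [|n IH]; first exact: nrm1_le1.
rewrite !exprS; apply: le_trans (nrmM _ _) _.
by rewrite ler_wpM2l// nrm_ge0.
Qed.

End Cstar.

(** * Square roots and the norm of a selfadjoint element *)

Section Sqrt.
Context {R : realType} {B : cstarAlgType R}.
Implicit Types (b c h s w x y z : B).

Lemma nrm_small_eq x y (C : R) :
  (forall e : R, 0 < e -> nrm (x - y) <= C * e) -> x = y.
Proof.
move=> H; apply/eqP; rewrite -subr_eq0; apply/eqP/nrm_eq0/le_anti.
rewrite nrm_ge0 andbT; apply/ler_addgt0Pr => e e0; rewrite add0r.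
have C0 : 0 < `|C| + 1 by rewrite ltr_wpDl.
have := H _ (divr_gt0 e0 C0) => /le_trans; apply.
rewrite mulrCA ler_piMr ?(ltW e0)// ler_pdivrMr// mul1r.
by rewrite (le_trans (ler_norm _))// lerDl.
Qed.

Lemma commutator_diff z x y : z * x - x * z - (z * y - y * z) = z * (x - y) - (x - y) * z.
Proof. by rewrite mulrBr mulrBl !opprB addrACA [RHS]addrACA; congr (_ + _); rewrite addrC. Qed.

Lemma commutes_lim z x : (forall e : R, 0 < e ->
    exists2 y, z * y = y * z & nrm (x - y) < e) -> z * x = x * z.
Proof.
move=> H; apply: (@nrm_small_eq _ _ (2 * nrm z)) => e /H [y zy xy].
have -> : z * x - x * z = z * (x - y) - (x - y) * z.
  by rewrite -commutator_diff zy subrr subr0.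
apply: le_trans (nrmB _ _) _.
have := nrmM z (x - y); have := nrmM (x - y) z.
have := nrm_ge0 z; nra.
Qed.

Lemma star_lim x : (forall e : R, 0 < e ->
    exists2 y, star y = y & nrm (x - y) < e) -> star x = x.
Proof.
move=> H; apply: (@nrm_small_eq _ _ 2) => e /H [y sy xy].
apply: le_trans (nrm_triangle y _ _) _.
rewrite -[in X in X + _]sy -starB nrm_star (nrmBC y); lra.
Qed.

Lemma sqrB_split x y : x * x - y * y = x * (x - y) + (x - y) * y.
Proof. by rewrite mulrBr mulrBl addrA subrK. Qed.

(** Picard iteration for [l = (b + l * l) / 2], an equation equivalent to [(1 - l)^2 = 1 - b]. *)
Fixpoint sqrt_iter b n : B :=
  if n is n'.+1 then (2^-1)%:C *: (b + sqrt_iter b n' * sqrt_iter b n') else 0.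

(* The iterates for b = 1, which dominate all the others. *)
Fixpoint sqrt_bound n : R :=
  if n is n'.+1 then 2^-1 * (1 + sqrt_bound n' * sqrt_bound n') else 0.

Lemma sqrt_bound01 n : 0 <= sqrt_bound n <= 1.
Proof. by elim: n => [|n /andP[h1 h2]] /=; [rewrite lexx ler01|apply/andP; split; nra]. Qed.

Lemma nrm_sqrt_iter b n : nrm b <= 1 -> nrm (sqrt_iter b n) <= sqrt_bound n.
Proof.
move=> b1; elim: n => [|n IH] /=; first by rewrite nrm0.
rewrite nrmZr ger0_norm; last by lra.
rewrite ler_wpM2l; [by []|lra|].
apply: le_trans (nrmD _ _) _; rewrite lerD//; apply: le_trans (nrmM _ _) _.
by rewrite ler_pM// nrm_ge0.
Qed.

Lemma nrm_sqrt_iterB b n : nrm b <= 1 ->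
  nrm (sqrt_iter b n.+1 - sqrt_iter b n) <= sqrt_bound n.+1 - sqrt_bound n.
Proof.
move=> b1; elim: n => [|n IH].
  by rewrite /= mul0r !addr0 !subr0 mulr0 addr0 nrmZr ger0_norm; lra.
have Es k : sqrt_iter b k.+1 =
    (2^-1)%:C *: (b + sqrt_iter b k * sqrt_iter b k) by [].
rewrite (Es n.+1) [X in _ - X](Es n) -scalerBr opprD addrACA subrr add0r
  sqrB_split nrmZr ger0_norm; last by lra.
have -> : sqrt_bound n.+2 - sqrt_bound n.+1 = 2^-1 *
    (sqrt_bound n.+1 * (sqrt_bound n.+1 - sqrt_bound n) +
     (sqrt_bound n.+1 - sqrt_bound n) * sqrt_bound n).
  have E k : sqrt_bound k.+1 = 2^-1 * (1 + sqrt_bound k * sqrt_bound k) by [].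
  rewrite (E n.+1); move: (sqrt_bound n) (sqrt_bound n.+1) (E n) => v u; lra.
rewrite ler_wpM2l; [by []|lra|].
apply: le_trans (nrmD _ _) _; rewrite lerD//; apply: le_trans (nrmM _ _) _.
  by rewrite ler_pM ?nrm_ge0// nrm_sqrt_iter.
by rewrite ler_pM ?nrm_ge0// nrm_sqrt_iter.
Qed.

Lemma sqrt_iter_selfadj b n : star b = b -> star (sqrt_iter b n) = sqrt_iter b n.
Proof. by move=> sb; elim: n => [|n IH] /=; rewrite ?star0// starZr starD star_mul sb IH. Qed.

Lemma sqrt_iter_commutes b z n : z * b = b * z ->
  z * sqrt_iter b n = sqrt_iter b n * z.
Proof.
move=> zb; elim: n => [|n IH] /=; first by rewrite mulr0 mul0r.
by rewrite -cscalerAr -cscalerAl mulrDr mulrDl zb mulrA IH -mulrA IH mulrA.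
Qed.

Lemma half_addxx x : (2^-1)%:C *: (x + x) = x.
Proof.
rewrite scalerDr -scalerDl -rmorphD.
have -> : 2^-1 + 2^-1 = 1 :> R by lra. by rewrite rmorph1 scale1r.
Qed.

(** Take [s = 1 - l] with [l] the limit of [sqrt_iter]; selfadjointness and commutation hold for the
    iterates and pass to the limit. *)
Lemma sqrt_one_sub b : star b = b -> nrm b <= 1 ->
  exists s, [/\ star s = s, s * s = 1 - b &
    forall z, z * b = b * z -> z * s = s * z].
Proof.
move=> sb b1.
have [l lP] : exists l, forall e : R, 0 < e -> exists N, forall n, (N <= n)%N ->
    nrm (l - sqrt_iter b n) < e.
  apply: (@dominated_increments_cvg _ _ _ sqrt_bound 1).
    by move=> n; have /andP[] := sqrt_bound01 n.
  by move=> n; apply: nrm_sqrt_iterB.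
have sl : star l = l.
  apply: star_lim => e /lP [N /(_ N (leqnn N)) h].
  by exists (sqrt_iter b N) => //; apply: sqrt_iter_selfadj.
have lE : l = (2^-1)%:C *: (b + l * l).
  (* One [e] comes from the next iterate and at most [(nrm l + 1) * e / 2] from the difference of
     the squares. *)
  apply: (@nrm_small_eq _ _ (2 + nrm l)) => e /lP [N NP].
  have h1 := NP N (leqnn N); have h2 := NP _ (leqnSn N).
  apply: le_trans (nrm_triangle (sqrt_iter b N.+1) _ _) _.
  have -> : sqrt_iter b N.+1 - (2^-1)%:C *: (b + l * l) =
      - ((2^-1)%:C *: (l * (l - sqrt_iter b N) + (l - sqrt_iter b N) * sqrt_iter b N)).
    by rewrite -sqrB_split /= -scalerBr -scalerN opprD addrACA subrr add0r opprB.
  rewrite nrmN nrmZr ger0_norm; last by lra.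
  have h3 := nrmD (l * (l - sqrt_iter b N)) ((l - sqrt_iter b N) * sqrt_iter b N).
  have h4 := nrmM l (l - sqrt_iter b N).
  have h5 := nrmM (l - sqrt_iter b N) (sqrt_iter b N).
  have h6 : nrm (sqrt_iter b N) <= 1.
    by apply: le_trans (nrm_sqrt_iter _ _ b1) _; have /andP[] := sqrt_bound01 N.
  have h7 := ler_wpM2l (nrm_ge0 l) (ltW h1).
  have h8 := ler_wpM2l (nrm_ge0 (l - sqrt_iter b N)) h6.
  have h9 : 0 <= nrm l * e
    by rewrite mulr_ge0 ?nrm_ge0//; apply: le_trans (ltW h1); apply: nrm_ge0.
  have := nrm_ge0 (l - sqrt_iter b N); lra.
exists (1 - l); split.
- by rewrite starB star1 sl.
- have -> : b = l + l - l * l.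
    by apply/eqP; rewrite eq_sym subr_eq {1 2}lE -scalerDr half_addxx.
  rewrite mulrBr mulr1 mulrBl mul1r !opprB opprD -!addrA; congr (1 + _);
    by rewrite addrCA.
move=> z zb; rewrite mulrBr mulrBl mulr1 mul1r; congr (_ - _).
apply: commutes_lim => e /lP [N /(_ N (leqnn N)) h].
by exists (sqrt_iter b N) => //; apply: sqrt_iter_commutes.
Qed.

(** The element [u = h + 'i *: w] has real part [h], so [|h| <= |u|], and by commutation
    [star u * u] is the sum of the squares. *)
Lemma nrm_le_sum_sqr h w : star h = h -> star w = w -> h * w = w * h ->
  nrm h ^+ 2 <= nrm (h * h + w * w).
Proof.
move=> sh sw hw; pose u := h + 'i *: w.
have su : star u = h - 'i *: w.
  rewrite starD starZc sh sw -scaleNr; congr (_ + _ *: _).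
  by apply/eqP; rewrite eq_complex /= oppr0 !eqxx.
have uu : star u * u = h * h + w * w.
  rewrite su mulrDr !mulrBl -cscalerAl -!cscalerAr -cscalerAl scalerA hw.
  have -> : 'i * 'i = -1 :> R[i] by rewrite -expr2 sqr_i.
  by rewrite scaleN1r opprK addrA subrK.
have hu : h = (2^-1)%:C *: (u + star u) by rewrite su addrACA subrr addr0 half_addxx.
rewrite -uu nrm_starM ler_sqr ?nnegrE ?nrm_ge0// {1}hu nrmZr ger0_norm; last by lra.
have := nrmD u (star u); rewrite nrm_star; lra.
Qed.

Lemma inverse_commutes x c z : x * c = 1 -> c * x = 1 -> z * x = x * z ->
  z * c = c * z.
Proof.
move=> xc cx zx.
by rewrite -[z * c]mul1r -cx -(mulrA c) (mulrA x z) -zx -(mulrA z) xc mulr1.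
Qed.

Lemma norm_in_spectrum h c : star h = h -> nrm h = 1 ->
  (1 - h * h) * c = 1 -> c * (1 - h * h) = 1 -> False.
Proof.
move=> sh nh xc cx.
have sx : star (1 - h * h) = 1 - h * h by rewrite starB star1 star_mul sh.
have sc : star c = c.
  by rewrite -[star c]mulr1 -xc mulrA -{1}sx -star_mul xc star1 mul1r.
have hx : h * (1 - h * h) = (1 - h * h) * h.
  by rewrite mulrBr mulrBl mulr1 mul1r mulrA.
have hc := inverse_commutes _ _ _ xc cx hx.
have [||s [ss s2 sC]] := @sqrt_one_sub (h * h).
- by rewrite star_mul sh.
- by apply: le_trans (nrmM _ _) _; rewrite nh mulr1.
(* The maximum with 1 gives [c / t] norm at most 1 and keeps [t^-1] in [(0, 1]]. *)
pose t := Num.max (nrm c) 1.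
have t1 : 1 <= t by rewrite le_max lexx orbT.
have ct : nrm c <= t by rewrite le_max lexx.
have t0 : 0 < t by lra.
have [||r [sr r2 rC]] := @sqrt_one_sub ((t^-1)%:C *: c).
- by rewrite starZr sc.
- by rewrite nrmZr ger0_norm ?invr_ge0 ?(ltW t0)// mulrC ler_pdivrMr// mul1r.
have rC' z : z * c = c * z -> z * r = r * z.
  by move=> zc; apply: rC; rewrite -cscalerAr -cscalerAl zc.
have cs : c * s = s * c by apply: sC; rewrite mulrA -hc -mulrA -hc mulrA.
have sr' : s * r = r * s by apply: rC'.
have hs : h * s = s * h by apply: sC; rewrite mulrA.
have hr : h * r = r * h by apply: rC'.
have sw : star (s * r) = s * r by rewrite star_mul ss sr sr'.
have hw : h * (s * r) = s * r * h by rewrite mulrA hs -mulrA hr mulrA.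
(* As [c] inverts [1 - h * h], the product of [1 - h * h] and [1 - c / t] loses its factor [c]. *)
have ww : s * r * (s * r) = 1 - h * h - (t^-1)%:C *: (1 : B).
  rewrite -mulrA (mulrA r) -sr' -mulrA r2 mulrA s2 mulrBr mulr1.
  by rewrite -cscalerAr xc.
have := nrm_le_sum_sqr _ _ sh sw hw.
have -> : h * h + s * r * (s * r) = (1 - t^-1)%:C *: (1 : B).
  by rewrite ww addrCA addrA addrNK rmorphB /= scalerBl scale1r.
have ti : t^-1 <= 1 by rewrite invf_le1.
have ti0 : 0 < t^-1 by rewrite invr_gt0.
rewrite nh expr1n nrmZr ger0_norm ?subr_ge0//.
have := @nrm1_le1 R B; have := nrm_ge0 (1 : B); nra.
Qed.

End Sqrt.

(** * Polynomials and the spectrum *)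

Section PolyEval.
Context {R : realType} {B : cstarAlgType R}.
Implicit Types (a x y : B) (p q : {poly R[i]}) (c : R[i]).

Definition peval x p : B := \sum_(i < size p) p`_i *: x ^+ i.

Lemma peval_wide n x p : (size p <= n)%N ->
  peval x p = \sum_(i < n) p`_i *: x ^+ i.
Proof.
move=> pn; rewrite /peval (big_ord_widen n (fun i => p`_i *: x ^+ i))// big_mkcond.
apply: eq_bigr => i _ /=; case: ltnP => // /leq_sizeP/(_ _ (leqnn _)) ->.
by rewrite scale0r.
Qed.

Lemma pevalD x p q : peval x (p + q) = peval x p + peval x q.
Proof.
rewrite (peval_wide _ _ _ (size_polyD p q)) (peval_wide _ _ _ (leq_maxl _ (size q))).
rewrite (peval_wide _ _ _ (leq_maxr (size p) _)).
by rewrite -big_split /=; apply: eq_bigr => i _; rewrite coefD scalerDl.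
Qed.

Lemma pevalZ x c p : peval x (c *: p) = c *: peval x p.
Proof.
rewrite (peval_wide (size p)) ?size_scale_leq// /peval scaler_sumr.
by apply: eq_bigr => i _; rewrite coefZ scalerA.
Qed.

Lemma peval0 x : peval x 0 = 0.
Proof. by rewrite /peval size_poly0 big_ord0. Qed.

Lemma pevalC x c : peval x c%:P = c *: (1 : B).
Proof. by rewrite (peval_wide 1) ?size_polyC_leq1// big_ord1 coefC expr0. Qed.

Lemma peval1 x : peval x 1 = 1.
Proof. by rewrite pevalC scale1r. Qed.

Lemma pevalN x p : peval x (- p) = - peval x p.
Proof. by rewrite -scaleN1r pevalZ scaleN1r. Qed.

Lemma pevalB x p q : peval x (p - q) = peval x p - peval x q.
Proof. by rewrite pevalD pevalN. Qed.

Lemma pevalMX x p : peval x (p * 'X) = peval x p * x.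
Proof.
rewrite (peval_wide (size p).+1); last first.
  have [->|p0] := eqVneq p 0; first by rewrite mul0r size_poly0.
  by rewrite size_mulX.
rewrite big_ord_recl coefMX /= scale0r add0r /peval mulr_suml.
by apply: eq_bigr => i _; rewrite coefMX /= exprSr cscalerAl.
Qed.

Lemma pevalX x : peval x 'X = x.
Proof. by rewrite -[X in peval _ X]mul1r pevalMX peval1 mul1r. Qed.

Lemma pevalM x p q : peval x (p * q) = peval x p * peval x q.
Proof.
elim/poly_ind: q => [|q c IH]; first by rewrite mulr0 peval0 mulr0.
rewrite mulrDr mulrA pevalD pevalMX IH pevalD pevalMX pevalC mulrDr mulrA.
by rewrite mulrC mul_polyC pevalZ -cscalerAr mulr1.
Qed.

Lemma peval_comm x p : x * peval x p = peval x p * x.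
Proof. by rewrite -[X in X * _]pevalX -pevalM mulrC pevalMX. Qed.

Lemma star_peval x p : star x = x ->
  star (peval x p) = peval x (map_poly conjc p).
Proof.
move=> sx; elim/poly_ind: p => [|p c IH]; first by rewrite rmorph0 !peval0 star0.
rewrite rmorphD rmorphM /= map_polyX map_polyC !pevalD !pevalC starD starZc star1.
by rewrite !pevalMX star_mul IH sx peval_comm.
Qed.

Definition rpoly (p : {poly R}) : {poly R[i]} := map_poly (real_complex R) p.

Lemma star_rpoly x (p : {poly R}) : star x = x ->
  star (peval x (rpoly p)) = peval x (rpoly p).
Proof.
move=> sx; rewrite star_peval// /rpoly -map_poly_comp.
by congr (peval x _); apply: eq_map_poly => r; exact: conjc_real.
Qed.

Lemma horner_rpoly (p : {poly R}) (r : R) : (rpoly p).[r%:C] = (p.[r])%:C.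
Proof. exact: horner_map. Qed.

Lemma horner_conj_real p (r : R) :
  (map_poly conjc p).[r%:C] = conjc p.[r%:C].
Proof. by rewrite -[in LHS](conjc_real r) (horner_map conjc). Qed.

(** Each Horner step splits the difference of two products; requiring [|x - y| < 1] bounds [|y|] by
    [|x| + 1]. *)
Lemma peval_continuous x p (e : R) : 0 < e -> exists2 d : R, 0 < d &
  forall y, nrm (x - y) < d -> nrm (peval x p - peval y p) <= e.
Proof.
elim/poly_ind: p e => [|p c IH] e e0.
  by exists 1 => // y _; rewrite !peval0 subrr nrm0 ltW.
have Y0 : 0 < nrm x + 1 by rewrite ltr_wpDl ?nrm_ge0.
have P0 : 0 < nrm (peval x p) + 1 by rewrite ltr_wpDl ?nrm_ge0.
have [d d0 dP] := IH _ (divr_gt0 (divr_gt0 e0 (ltr0n R 2)) Y0).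
exists (Num.min d (Num.min 1 (e / 2 / (nrm (peval x p) + 1)))).
  by rewrite !lt_min d0 ltr01 divr_gt0// divr_gt0.
move=> y; rewrite !lt_min => /and3P[/dP h1 h2 h3].
rewrite !pevalD !pevalMX !pevalC opprD addrACA subrr addr0.
have -> : peval x p * x - peval y p * y =
    peval x p * (x - y) + (peval x p - peval y p) * y.
  by rewrite mulrBr mulrBl addrA subrK.
have h4 : nrm y <= nrm x + 1.
  have := nrmB x (x - y); rewrite subKr; lra.
have h5 := nrmM (peval x p) (x - y).
have h6 := nrmM (peval x p - peval y p) y.
apply: le_trans (nrmD _ _) _; rewrite [leRHS](splitr e) lerD//.
  apply: le_trans h5 _; move: h3; rewrite ltr_pdivlMr// => /ltW; apply: le_trans.
  by rewrite mulrC ler_wpM2l ?nrm_ge0// lerDl.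
apply: le_trans h6 _; move: h1; rewrite ler_pdivlMr//; apply: le_trans.
by rewrite ler_wpM2l ?nrm_ge0.
Qed.

Lemma peval_sub_cstar A x p : sub_cstar A -> A x -> A (peval x p).
Proof.
move=> hA Ax; elim/poly_ind: p => [|p c IH].
  by rewrite peval0 -(scale0r (1 : B)); apply: sub_cstarZ => //; apply: sub_cstar1.
rewrite pevalD pevalMX pevalC; apply: sub_cstarD => //.
  exact: sub_cstarM.
by apply: sub_cstarZ => //; apply: sub_cstar1.
Qed.

End PolyEval.

(** * Invertibility and spectrum relative to a sub-C*-algebra *)

Section Spectrum.
Context {R : realType} {B : cstarAlgType R}.
Variable A : set B.
Hypothesis hA : sub_cstar A.
Implicit Types (a x y : B) (p q : {poly R[i]}) (c z : R[i]).

Let A1 : A 1. Proof. exact: sub_cstar1. Qed.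
Let AD x y : A x -> A y -> A (x + y). Proof. exact: sub_cstarD. Qed.
Let AM x y : A x -> A y -> A (x * y). Proof. exact: sub_cstarM. Qed.
Let AZ c x : A x -> A (c *: x). Proof. exact: sub_cstarZ. Qed.
Let AN x : A x -> A (- x). Proof. by rewrite -scaleN1r; apply: AZ. Qed.
Let AB x y : A x -> A y -> A (x - y). Proof. by move=> Ax /AN; apply: AD. Qed.

Definition inv_in x := exists2 b, A b & x * b = 1 /\ b * x = 1.

Lemma inv_in1 : inv_in 1.
Proof. by exists 1; rewrite ?mulr1. Qed.

Lemma inv_inM x y : inv_in x -> inv_in y -> inv_in (x * y).
Proof.
move=> [b Ab [xb bx]] [d Ad [yd dy]]; exists (d * b); first exact: AM.
by rewrite mulrA -(mulrA x) yd mulr1 xb mulrA -(mulrA d) bx mulr1 dy.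
Qed.

Lemma inv_inZ c x : c != 0 -> inv_in x -> inv_in (c *: x).
Proof.
move=> c0 [b Ab [xb bx]]; exists (c^-1 *: b); first exact: AZ.
by rewrite -!cscalerAl -!cscalerAr !scalerA xb bx mulfV// mulVf// scale1r.
Qed.

(** If [b] inverts [x * y], then [y * b] is a right inverse of [x] and [b * y] a left one, hence
    they coincide. *)
Lemma inv_in_commuting x y : A y -> x * y = y * x -> inv_in (x * y) -> inv_in x.
Proof.
move=> Ay xy [b Ab [h1 h2]]; exists (y * b); first exact: AM.
split; first by rewrite mulrA.
have e : b * y * x = 1 by rewrite -mulrA -xy.
suff -> : y * b = b * y by [].
by rewrite -[LHS]mul1r -e -[LHS]mulrA (mulrA x y b) h1 mulr1.
Qed.

(** The partial sums [u] of the geometric series stay in the closed set [A], and their limit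
    satisfies [l = 1 + x * l]. *)
Lemma neumann x : A x -> nrm x < 1 -> inv_in (1 - x).
Proof.
move=> Ax x1; pose u := fix u n := if n is n'.+1 then 1 + x * u n' else 0 : B.
have uS n : u n.+1 - u n = x ^+ n.
  elim: n => [|n IH]; first by rewrite /= mulr0 addr0 subr0.
  rewrite [u n.+2]/= [X in _ - X]/= opprD addrACA subrr add0r -mulrBr.
  by rewrite -/(u n.+1) IH exprS.
have [l lP] : exists l, forall e : R, 0 < e -> exists N, forall n, (N <= n)%N ->
    nrm (l - u n) < e.
  have d0 : 0 < 1 - nrm x by lra.
  apply: (@dominated_increments_cvg _ _ _ (fun n => (1 - nrm x ^+ n) / (1 - nrm x))
     (1 / (1 - nrm x))) => n.
    by rewrite ler_pM2r ?invr_gt0// gerBl exprn_ge0 ?nrm_ge0.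
  rewrite uS; apply: le_trans (nrmX _ _) _.
  by rewrite exprS -mulrBl le_eqVlt; apply/orP; left; apply/eqP; field; rewrite gt_eqF.
have Au n : A (u n).
  elim: n => [|n IH] /=; first by rewrite -(subrr (1 : B)); apply: AB.
  by apply: AD => //; apply: AM.
have lE : l = 1 + x * l.
  apply: (@nrm_small_eq _ _ _ _ 2) => e /lP [N NP].
  have h1 := NP N (leqnn N); have h2 := NP _ (leqnSn N).
  apply: le_trans (nrm_triangle (u N.+1) _ _) _.
  have -> : u N.+1 - (1 + x * l) = x * (u N - l).
    by rewrite /= opprD addrACA subrr add0r mulrBr.
  have := nrmM x (u N - l); rewrite (nrmBC (u N)).
  have := nrm_ge0 (l - u N); nra.
have xl : x * l = l * x.
  apply: commutes_lim => e /lP [N /(_ N (leqnn N)) h]; exists (u N) => //.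
  elim: N {h} => [|n IH] /=; first by rewrite mulr0 mul0r.
  by rewrite mulrDr mulrDl mulr1 mul1r -mulrA IH.
exists l; last by rewrite mulrBl mulrBr mul1r mulr1 -xl {1 3}lE addrK.
apply: (iffLR (closedP _) (sub_cstar_closed hA)) => e /lP [N /(_ N (leqnn N)) h].
by exists (u N).
Qed.

Lemma inv_in_large x z : A x -> nrm x < nrm z -> inv_in (x - z *: (1 : B)).
Proof.
move=> Ax xz; have z0 : 0 < nrm z by apply: le_lt_trans xz; exact: nrm_ge0.
have z0' : z != 0 by apply: contraTneq z0 => ->; rewrite nrm0 ltxx.
have -> : x - z *: (1 : B) = (- z) *: (1 - z^-1 *: x).
  by rewrite scalerBr scalerA mulNr mulfV// scaleN1r opprK scaleNr addrC.
apply: inv_inZ; first by rewrite oppr_eq0.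
apply: neumann; first exact: AZ.
have nz : nrm z * nrm z^-1 = 1 by rewrite -nrmMc mulfV// nrmc1.
rewrite nrmZ -nz mulrC ltr_pM2r// -(ltr_pM2l z0) nz mulr0; lra.
Qed.

Lemma not_spectrum a z : ~ spectrum A a z <-> inv_in (a - z *: (1 : B)).
Proof. by split=> [/contrapT|h /(_ h)]. Qed.

Lemma spectrum_bound a z : A a -> spectrum A a z -> nrm z <= nrm a.
Proof. by move=> Aa sz; rewrite leNgt; apply/negP => /(inv_in_large _ _ Aa). Qed.

(** For [z = s + it] with [t] nonzero, [a - z] equals [(y + im) - i(t + m)]. The C*-identity gives
    [|y + im|^2 <= |y|^2 + m^2], and [inv_in_large] applies once this is less than [(t + m)^2]. *)
Lemma spectrum_real a z : A a -> star a = a -> spectrum A a z ->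
  z = (complex.Re z)%:C.
Proof.
move=> Aa sa; case: z => s t sz /=; suff -> : t = 0 by [].
apply/eqP; apply: contrapT => /negP t0; apply: sz.
pose y := a - s%:C *: (1 : B).
have sy : star y = y by rewrite starB starZr star1 sa.
(* With this [m], [(t + m)^2] exceeds [|y|^2 + m^2] by [t^2 + 1]. *)
pose m := (nrm y ^+ 2 + 1) / (2 * t).
have mE : 2 * t * m = nrm y ^+ 2 + 1.
  by rewrite /m mulrC divfK// mulf_neq0// pnatr_eq0.
have -> : a - (s +i* t) *: (1 : B) = y + (0 +i* m) *: (1 : B) - (0 +i* (t + m)) *: (1 : B).
  rewrite /y -!addrA -!scaleNr -!scalerDl; congr (_ + _ *: _).
  by apply/eqP; rewrite eq_complex /=; apply/andP; split; apply/eqP; ring.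
apply: inv_in_large; first by apply: AD; [apply: AB => //|]; apply: AZ.
move: y m sy mE => y m sy mE.
have -> : nrm (0 +i* (t + m)) = `|t + m|.
  by rewrite /nrm normc_def /= expr0n add0r sqrtr_sqr.
rewrite -ltr_sqr ?nnegrE ?nrm_ge0// -nrm_starM real_normK ?num_real//.
have -> : star (y + (0 +i* m) *: (1 : B)) * (y + (0 +i* m) *: (1 : B)) =
    y ^+ 2 + (m ^+ 2)%:C *: (1 : B).
  rewrite starD sy starZc star1 mulrDr !mulrDl -!cscalerAl -!cscalerAr !mul1r !mulr1.
  rewrite scalerA addrA -(addrA (y * y)) -scalerDl.
  have -> : conjc (0 +i* m) + (0 +i* m) = 0.
    by apply/eqP; rewrite eq_complex /=; apply/andP; split; apply/eqP; ring.
  rewrite scale0r addr0 expr2; congr (_ + _ *: _).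
  by apply/eqP; rewrite eq_complex /=; apply/andP; split; apply/eqP; ring.
apply: le_lt_trans (nrmD _ _) _; rewrite nrm_sqr// nrmZr ger0_norm ?sqr_ge0//.
have := ler_wpM2l (sqr_ge0 m) (@nrm1_le1 R B); rewrite mulr1 => h1.
have := sqr_ge0 t; nra.
Qed.

(** The factor ['X - z] divides [p - p.[z]], and invertibility of the product would pass to its
    commuting factor [a - z]. *)
Lemma spectrum_peval a p z : A a -> spectrum A a z ->
  spectrum A (peval a p) p.[z].
Proof.
move=> Aa sz h; apply: sz; have /factor_theorem [q qE] : root (p - (p.[z])%:P) z.
  by rewrite rootE !hornerE subrr.
have pE : peval a p - p.[z] *: (1 : B) = (a - z *: (1 : B)) * peval a q.
  by rewrite -(pevalC a p.[z]) -pevalB qE mulrC pevalM pevalB pevalX pevalC.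
apply: (@inv_in_commuting _ (peval a q)); first exact: peval_sub_cstar.
  by rewrite mulrBl mulrBr peval_comm -cscalerAl mul1r -cscalerAr mulr1.
by rewrite -pE.
Qed.

Lemma peval_ge_spectrum a p z : A a -> spectrum A a z ->
  nrm (p.[z]) <= nrm (peval a p).
Proof.
by move=> Aa /(spectrum_peval _ p _ Aa)/spectrum_bound; apply; apply: peval_sub_cstar.
Qed.

(** Over the complex numbers [p] splits into linear factors, and none of its roots is in the
    spectrum. *)
Lemma inv_in_peval a p : A a -> p != 0 -> (forall z, spectrum A a z -> p.[z] != 0) ->
  inv_in (peval a p).
Proof.
move=> Aa p0 H; have [r rE] := closed_field_poly_normal p.
have : forall z, z \in r -> inv_in (a - z *: (1 : B)).
  move=> z zr; apply/not_spectrum => /H; rewrite rE hornerZ mulf_eq0 negb_or.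
  by move=> /andP[_]; rewrite -[_ == 0]/(root _ z) root_prod_XsubC zr.
rewrite rE pevalZ => {rE H} H; apply: inv_inZ; first by rewrite lead_coef_eq0.
elim: r H => [|z r IH] H; first by rewrite big_nil peval1; apply: inv_in1.
rewrite big_cons pevalM; apply: inv_inM.
  by rewrite pevalB pevalX pevalC; apply: H; rewrite mem_head.
by apply: IH => w wr; apply: H; rewrite in_cons wr orbT.
Qed.

(** With an empty spectrum every nonzero polynomial in [a] would be invertible, in particular
    [1 - (a / |a|)^2], against [norm_in_spectrum]. If [a = 0], the spectrum contains 0. *)
Lemma spectrum_neq0 a : A a -> star a = a -> (1 : B) != 0 ->
  exists z, spectrum A a z.
Proof.
move=> Aa sa B0; apply: contrapT => /forallNP H.
have [a0|a0] := eqVneq (nrm a) 0.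
  apply: (H 0) => -[b _ []]; rewrite (nrm_eq0 _ a0) scale0r subrr mul0r.
  by move=> e; rewrite -e eqxx in B0.
have n0 : 0 < nrm a by rewrite lt_neqAle eq_sym a0 nrm_ge0.
pose q : {poly R[i]} := ((nrm a)^-1)%:C *: 'X.
have hE : peval a q = ((nrm a)^-1)%:C *: a by rewrite pevalZ pevalX.
have q0 : 1 - q * q != 0.
  have qz : q.[0] = 0 by rewrite /q hornerZ hornerX mulr0.
  apply/eqP => /(congr1 (fun p => p.[0])); rewrite hornerD hornerN hornerM qz.
  by rewrite hornerC horner0 mulr0 subr0 => /eqP; rewrite oner_eq0.
have [c Ac] : inv_in (peval a (1 - q * q)).
  by apply: inv_in_peval => // z /H.
rewrite pevalB pevalM peval1 hE => -[c1 c2].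
apply: (@norm_in_spectrum _ _ (((nrm a)^-1)%:C *: a) c) => //.
  by rewrite starZr sa.
by rewrite nrmZr ger0_norm ?invr_ge0 ?nrm_ge0// mulVf.
Qed.

(** If [N = |p(a)| > M], then [h = star p(a) * p(a) / N^2] is selfadjoint of norm 1 and equals
    [q(a)] with [0 <= q < 1] on the spectrum. So [1 - h^2] is invertible, against
    [norm_in_spectrum]. *)
Lemma nrm_peval_le a p (M : R) : A a -> star a = a -> 0 <= M ->
  (forall z, spectrum A a z -> nrm (p.[z]) <= M) ->
  nrm (peval a p) <= M.
Proof.
move=> Aa sa M0 H; rewrite leNgt; apply/negP => MN.
set N := nrm (peval a p) in MN; have N0 : 0 < N by apply: le_lt_trans MN.
pose q := ((N ^+ 2)^-1)%:C *: (map_poly conjc p * p).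
pose h := peval a q.
have hE : h = ((N ^+ 2)^-1)%:C *: (star (peval a p) * peval a p).
  by rewrite /h pevalZ pevalM star_peval.
have sh : star h = h by rewrite hE starZr star_mul starK.
have nh : nrm h = 1.
  by rewrite hE nrmZr nrm_starM ger0_norm ?invr_ge0 ?sqr_ge0// mulVf// gt_eqF// exprn_gt0.
have hP : 1 - h * h = peval a (1 - q * q) by rewrite pevalB pevalM peval1.
have q1 z : spectrum A a z -> (1 - q * q).[z] != 0.
  move=> sz; have zr := spectrum_real _ _ Aa sa sz.
  have := H _ sz; set m := nrm _ => mM.
  have m0 : 0 <= m by apply: nrm_ge0.
  have qz : q.[z] = ((N ^+ 2)^-1 * m ^+ 2)%:C.
    rewrite hornerZ hornerM {1}zr horner_conj_real -zr rmorphM rmorphXn /=.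
    by congr (_ * _); rewrite -nrmE sqr_normc mulrC.
  have w1 : (N ^+ 2)^-1 * m ^+ 2 < 1.
    rewrite mulrC ltr_pdivrMr ?exprn_gt0// mul1r ltr_sqr ?nnegrE ?(ltW N0)//.
    exact: le_lt_trans mM MN.
  have w0 : 0 <= (N ^+ 2)^-1 * m ^+ 2 by rewrite mulr_ge0 ?sqr_ge0// invr_ge0 sqr_ge0.
  rewrite hornerD hornerN hornerM hornerC qz -rmorphM subr_eq0.
  by rewrite -(rmorph1 (real_complex R)) (inj_eq (@complexI R)) gt_eqF//; nra.
have B0 : (1 : B) != 0.
  by apply: contraTneq N0 => e; rewrite /N -[peval _ _]mulr1 e mulr0 nrm0 ltxx.
(* The absence of zeros on the spectrum yields a nonzero polynomial because the spectrum is
   nonempty. *)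
have q0 : 1 - q * q != 0.
  have [z /q1] := spectrum_neq0 _ Aa sa B0.
  by apply: contraNneq => ->; rewrite horner0.
have [c Ac [c1 c2]] := inv_in_peval _ _ Aa q0 q1.
apply: (@norm_in_spectrum _ _ h c) => //; rewrite hP//.
Qed.

(** If [b] inverts [a - t], then [a - s = (a - t) * (1 - (s - t) * b)] is invertible for [s] close
    to [t], by the Neumann series. *)
Lemma spectrum_closed a : A a -> closed [set t : R | spectrum A a t%:C].
Proof.
move=> Aa t H [b Ab [b1 b2]].
have d0 : 0 < (nrm b + 1)^-1 by rewrite invr_gt0 ltr_wpDl ?nrm_ge0.
have [|s [ss /= ts]] := H (ball t (nrm b + 1)^-1).
  by apply/nbhs_ballP; exists (nrm b + 1)^-1.
apply: ss.
have -> : a - s%:C *: (1 : B) =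
    (a - t%:C *: (1 : B)) * (1 - (s - t)%:C *: b).
  rewrite mulrBr mulr1 -cscalerAr b1 rmorphB /= scalerBl.
  by rewrite opprB addrA subrK.
apply: inv_inM; first by exists b.
apply: neumann; first exact: AZ.
rewrite nrmZr distrC; apply: (@le_lt_trans _ _ (`|t - s| * (nrm b + 1))).
  by rewrite ler_wpM2l// lerDl.
by rewrite -ltr_pdivlMr ?div1r// ltr_wpDl ?nrm_ge0.
Qed.
End Spectrum.

(** * Continuous functional calculus *)

Section Approximation.
Context {R : realType}.

Lemma withinP (S : set R[i]) (f : R[i] -> R[i]) :
  {within S, continuous f} <->
  forall x, S x -> forall e : R, 0 < e -> exists2 d : R, 0 < d &
    forall y, S y -> nrm (x - y) < d -> nrm (f x - f y) < e.
Proof.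
split.
  move/subspace_continuousP => H x Sx e e0; have := H x Sx.
  move/cvgrPdist_lt => /(_ e%:C); rewrite ltcR => /(_ e0).
  move=> /nbhs_ballP [d /= d0 dP].
  have dr : d = (complex.Re d)%:C by rewrite RRe_real// gtr0_real.
  exists (complex.Re d); first by rewrite -ltcR -dr.
  move=> y Sy xy; rewrite -ltcR -nrmE; apply: (dP y) => //.
  by rewrite /ball /= nrmE dr ltcR.
move=> H; apply/subspace_continuousP => x Sx; apply/cvgrPdist_lt => e e0.
have er : e = (complex.Re e)%:C by rewrite RRe_real// gtr0_real.
have [|d d0 dP] := H x Sx (complex.Re e); first by rewrite -ltcR -er.
apply/nbhs_ballP; exists d%:C; first by rewrite /= ltcR.
move=> y; rewrite /ball /= nrmE ltcR => xy Sy.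
by rewrite nrmE er ltcR; apply: dP.
Qed.

Lemma nrm_Re (z : R[i]) : `|complex.Re z| <= nrm z.
Proof. by rewrite -lecR -nrmE normc_ge_Re. Qed.

Lemma nrm_Im (z : R[i]) : `|complex.Im z| <= nrm z.
Proof.
suff -> : nrm z = nrm ('i * z).
  by apply: le_trans (nrm_Re ('i * z)); rewrite mulrC ReiNIm normrN.
by rewrite nrmMc /nrm normc_def /= expr0n expr1n add0r sqrtr1 mul1r.
Qed.

Lemma nrm_le_ReIm (z : R[i]) : nrm z <= `|complex.Re z| + `|complex.Im z|.
Proof.
rewrite {1}[z]complexE; apply: le_trans (nrmD _ _) _.
rewrite nrmMc !nrm_real lerD// /nrm normc_def /= expr0n expr1n add0r sqrtr1.
by rewrite mul1r.
Qed.

Lemma within_horner (S : set R[i]) (p : {poly R[i]}) :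
  {within S, continuous (fun z => p.[z])}.
Proof.
elim/poly_ind: p => [|p c IH]; apply/withinP => x Sx e e0.
  by exists 1 => // y _ _; rewrite !horner0 subrr nrm0.
have X0 : 0 < nrm x + 1 by rewrite ltr_wpDl ?nrm_ge0.
have P0 : 0 < nrm p.[x] + 1 by rewrite ltr_wpDl ?nrm_ge0.
have e2 : 0 < e / 2 by lra.
have [d d0 dP] := iffLR (withinP _ _) IH x Sx _ (divr_gt0 e2 X0).
exists (Num.min d (Num.min 1 (e / 2 / (nrm p.[x] + 1)))).
  by rewrite !lt_min d0 ltr01 divr_gt0.
move=> y Sy; rewrite !lt_min => /and3P[/(dP y Sy) h1 h2 h3].
rewrite !hornerMXaddC.
have -> : p.[x] * x + c - (p.[y] * y + c) = p.[x] * (x - y) + (p.[x] - p.[y]) * y.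
  by ring.
have h4 : nrm y <= nrm x + 1 by have := nrmB x (x - y); rewrite subKr; lra.
apply: le_lt_trans (nrmD _ _) _; rewrite !nrmMc.
have h5 : nrm p.[x] * nrm (x - y) <= e / 2.
  move: h3; rewrite ltr_pdivlMr// => /ltW; apply: le_trans.
  by rewrite mulrC ler_wpM2l ?nrm_ge0// lerDl.
have h6 : nrm (p.[x] - p.[y]) * (nrm x + 1) < e / 2 by rewrite -ltr_pdivlMr.
have h7 := ler_wpM2l (nrm_ge0 (p.[x] - p.[y])) h4.
lra.
Qed.

(** Tietze extends [g] from the closed set [S] to the line; Weierstrass then applies on
    [[-M, M]]. *)
Lemma compact_poly_approx (S : set R) (g : R -> R) (M e : R) : closed S ->
  (forall t, S t -> `|t| <= M) -> {within S, continuous g} -> 0 < e ->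
  exists p : {poly R}, forall t, S t -> `|g t - p.[t]| <= e.
Proof.
move=> cS SM cg e0.
have cptS : compact S.
  apply: (subclosed_compact cS (@segment_compact R (- M) M)) => t /SM.
  by rewrite ler_norml /= in_itv.
have [F F0 Fb] : exists2 F : R, 0 < F & forall t, S t -> `|g t| <= F.
  have : bounded_set [set g x | x in S].
    by apply: compact_bounded; apply: continuous_compact.
  move=> /ex_strict_bound_gt0 [F F0 Fb]; exists F => // x Sx.
  by apply/ltW/Fb; exists x.
have nR : normal_space R by exact: pseudometric_normal.
have [h [gh ch _]] := continuous_bounded_extension nR cS F0 cg Fb.
have [p pP] := @weierstrass R h M e e0 ch.
by exists p => t St; rewrite gh ?inE//; apply/pP/SM.
Qed.

(** Since [S] is real, the real and imaginary parts of [f] are functions of a real variable, each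
    approximated by a real polynomial. *)
Lemma complex_poly_approx (S : set R[i]) (f : R[i] -> R[i]) (M e : R) :
  (forall z, S z -> z = (complex.Re z)%:C) ->
  closed [set t : R | S t%:C] -> (forall z, S z -> nrm z <= M) ->
  {within S, continuous f} -> 0 < e ->
  exists p : {poly R[i]}, forall z, S z -> nrm (f z - p.[z]) <= e.
Proof.
move=> Sr cS SM cf e0; have e2 : 0 < e / 2 by lra.
have SM' t : S t%:C -> `|t| <= M by move/SM; rewrite nrm_real.
have part (u : R[i] -> R) : (forall z w, `|u z - u w| <= nrm (z - w)) ->
    exists p : {poly R}, forall t, S t%:C -> `|u (f t%:C) - p.[t]| <= e / 2.
  move=> uL; apply: (@compact_poly_approx [set t : R | S t%:C]
    (fun t => u (f t%:C)) M (e / 2) cS SM' _ e2).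
  apply/subspace_continuousP => t St; apply/cvgrPdist_lt => r r0.
  have [d d0 dP] := iffLR (withinP _ _) cf _ St _ r0.
  apply/nbhs_ballP; exists d => // s; rewrite /ball /= => ts Ss.
  apply: le_lt_trans (uL _ _) _; apply: dP => //.
  by rewrite -rmorphB /= nrm_real.
have [|p pP] := part (@complex.Re R).
  by move=> z w; apply: le_trans (nrm_Re _); rewrite raddfB.
have [|q qP] := part (@complex.Im R).
  by move=> z w; apply: le_trans (nrm_Im _); rewrite raddfB.
exists (rpoly p + 'i *: rpoly q) => z Sz; have zr := Sr _ Sz.
rewrite zr in Sz *; set t := complex.Re z in Sz *.
rewrite hornerD hornerZ !horner_rpoly; apply: le_trans (nrm_le_ReIm _) _.
have := pP _ Sz; have := qP _ Sz; case: (f t%:C) => x y /=.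
rewrite !mul0r !mul1r ?subr0 ?add0r ?addr0 ?oppr0; lra.
Qed.

End Approximation.

(** * Construction of the calculus as a limit of polynomials *)

Section Cfc.
Context {R : realType} {B : cstarAlgType R}.
Variables (A : set B) (a : B).
Hypotheses (hA : sub_cstar A) (Aa : A a) (sa : star a = a).
Implicit Types (f g : R[i] -> R[i]) (c d : B) (p q : {poly R[i]}).

(* Graph of the functional calculus, as the closure of the polynomial one. *)
Definition cfc_rel f c := forall e : R, 0 < e -> exists p,
  (forall z, spectrum A a z -> nrm (f z - p.[z]) <= e) /\
  nrm (c - peval a p) <= e.

Lemma cfc_rel_poly p : cfc_rel (fun z => p.[z]) (peval a p).
Proof.
move=> e e0; exists p; split; last by rewrite subrr nrm0 ltW.
by move=> z _; rewrite subrr nrm0 ltW.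
Qed.

Lemma cfc_relZ (l : R[i]) f c : cfc_rel f c -> cfc_rel (fun z => l * f z) (l *: c).
Proof.
move=> fc e e0; have l0 : 0 < nrm l + 1 by rewrite ltr_wpDl ?nrm_ge0.
have [p [h1 h2]] := fc _ (divr_gt0 e0 l0).
have key (r : R) : 0 <= r -> r <= e / (nrm l + 1) -> nrm l * r <= e.
  rewrite ler_pdivlMr// => r0 h; apply: le_trans h.
  by rewrite mulrC ler_wpM2l// lerDl.
exists (l *: p); split.
  by move=> z /h1; rewrite hornerZ -mulrBr nrmMc; apply: key; apply: nrm_ge0.
by rewrite pevalZ -scalerBr nrmZ; apply: key => //; apply: nrm_ge0.
Qed.

Lemma cfc_relD f g c d : cfc_rel f c -> cfc_rel g d ->
  cfc_rel (fun z => f z + g z) (c + d).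
Proof.
move=> fc gd e e0; have e2 : 0 < e / 2 by lra.
have [p [p1 p2]] := fc _ e2; have [q [q1 q2]] := gd _ e2.
exists (p + q); split.
  move=> z sz; rewrite hornerD opprD addrACA; apply: le_trans (nrmD _ _) _.
  have := p1 z sz; have := q1 z sz; lra.
rewrite pevalD opprD addrACA; apply: le_trans (nrmD _ _) _; lra.
Qed.

(** For polynomials the two directions are [peval_ge_spectrum] and [nrm_peval_le]; approximation
    within [e / 2] carries them over to [f] and [c]. *)
Lemma cfc_rel_isometry f c (M : R) : cfc_rel f c -> 0 <= M ->
  nrm c <= M <-> forall z, spectrum A a z -> nrm (f z) <= M.
Proof.
move=> fc M0; split.
  move=> cM z sz; apply/ler_addgt0Pr => e e0.
  have e2 : 0 < e / 2 by lra.
  have [p [/(_ _ sz) p1 p2]] := fc _ e2.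
  have := peval_ge_spectrum _ hA _ p _ Aa sz.
  have := nrmD (f z - p.[z]) p.[z]; rewrite subrK.
  have := nrmD (- (c - peval a p)) c; rewrite opprB subrK nrmBC; lra.
move=> H; apply/ler_addgt0Pr => e e0; have e2 : 0 < e / 2 by lra.
have [p [p1 p2]] := fc _ e2.
have pM : nrm (peval a p) <= M + e / 2.
  apply: (@nrm_peval_le _ _ _ hA) => //; first by lra.
  move=> z sz; have := p1 z sz; have := H z sz.
  have := nrmD (p.[z] - f z) (f z); rewrite subrK nrmBC; lra.
have := nrmD (c - peval a p) (peval a p); rewrite subrK; lra.
Qed.

(** The difference [c - d] represents the zero function, so the isometry with [M = 0] kills it. *)
Lemma cfc_rel_uniq f c d : cfc_rel f c -> cfc_rel f d -> c = d.
Proof.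
move=> fc fd; apply/eqP; rewrite -subr_eq0; apply/eqP/nrm_eq0/le_anti.
rewrite nrm_ge0 andbT -scaleN1r.
apply/(cfc_rel_isometry _ _ _ (cfc_relD _ _ _ _ fc (cfc_relZ (-1) _ _ fd)) (lexx 0)) => z _.
by rewrite mulN1r subrr nrm0.
Qed.

Lemma cfc_relM f g c d : cfc_rel f c -> cfc_rel g d ->
  cfc_rel (fun z => f z * g z) (c * d).
Proof.
move=> fc gd e e0; set F := nrm c; set G := nrm d.
have F0 : 0 <= F by apply: nrm_ge0.
have G0 : 0 <= G by apply: nrm_ge0.
(* The error of the product is at most [F * r + r * (G + r)], hence at most [r * (F + G + 1)] as
   [r <= 1]. *)
pose r := Num.min 1 (e / (F + G + 1)).
have D0 : 0 < F + G + 1 by lra.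
have r0 : 0 < r by rewrite lt_min ltr01 divr_gt0.
have r1 : r <= 1 by rewrite ge_min lexx.
have re : r * (F + G + 1) <= e.
  by rewrite -ler_pdivlMr// ge_min lexx orbT.
have [p [p1 p2]] := fc _ r0; have [q [q1 q2]] := gd _ r0.
have fF := iffLR (cfc_rel_isometry _ _ _ fc F0) (lexx F).
have gG := iffLR (cfc_rel_isometry _ _ _ gd G0) (lexx G).
have key (x y s t : R) : 0 <= x -> 0 <= y -> 0 <= s -> 0 <= t ->
   x <= F -> t <= r -> s <= r -> y <= G + r -> x * t + s * y <= e.
  move=> x0 y0 s0 t0 xF tr sr yG; apply: le_trans re.
  have h1 : x * t <= F * r by rewrite ler_pM.
  have h2 : s * y <= r * (G + r) by rewrite ler_pM.
  nra.
exists (p * q); split.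
  move=> z sz; rewrite hornerM.
  have -> : f z * g z - p.[z] * q.[z] = f z * (g z - q.[z]) + (f z - p.[z]) * q.[z].
    by ring.
  apply: le_trans (nrmD _ _) _; rewrite !nrmMc; apply: key => //; try exact: nrm_ge0.
  - exact: fF.
  - exact: q1.
  - exact: p1.
  have := q1 z sz; have := gG z sz.
  have := nrmD (q.[z] - g z) (g z); rewrite subrK nrmBC; lra.
rewrite pevalM.
have -> : c * d - peval a p * peval a q =
    c * (d - peval a q) + (c - peval a p) * peval a q.
  by rewrite mulrBr mulrBl addrA subrK.
apply: le_trans (nrmD _ _) _.
apply: (@le_trans _ _ (nrm c * nrm (d - peval a q) + nrm (c - peval a p) * nrm (peval a q))).
  by rewrite lerD ?nrmM.
apply: key => //; try exact: nrm_ge0.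
have := nrmD (peval a q - d) d; rewrite subrK nrmBC -/G; lra.
Qed.

Lemma nrm_conjc (z : R[i]) : nrm (conjc z) = nrm z.
Proof. by rewrite /nrm normcJ. Qed.

Lemma cfc_rel_star f c : cfc_rel f c -> cfc_rel (fun z => conjc (f z)) (star c).
Proof.
move=> fc e e0; have [p [p1 p2]] := fc _ e0; exists (map_poly conjc p); split.
  move=> z sz; have zr := spectrum_real _ hA _ _ Aa sa sz.
  by rewrite {2}zr horner_conj_real -zr -rmorphB nrm_conjc p1.
by rewrite -star_peval// -starB nrm_star.
Qed.

Lemma cfc_rel_in f c : cfc_rel f c -> A c.
Proof.
move=> fc; apply: (iffLR (closedP _) (sub_cstar_closed hA)) => e e0.
have e2 : 0 < e / 2 by lra.
have [p [_ p2]] := fc _ e2; exists (peval a p); first exact: peval_sub_cstar.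
lra.
Qed.

(** Polynomials within [2^-n] of [f] on the spectrum have Cauchy values at [a], because
    [nrm_peval_le] transfers uniform bounds from the spectrum to [B]. *)
Lemma cfc_rel_exists f : {within spectrum A a, continuous f} ->
  exists c, cfc_rel f c.
Proof.
move=> cf.
have [|P PP] := @choice nat {poly R[i]} (fun n p => forall z, spectrum A a z ->
    nrm (f z - p.[z]) <= (2^-1) ^+ n).
  move=> n.
  apply: (@complex_poly_approx _ _ _ (nrm a)) => //.
  - by move=> z; apply: spectrum_real.
  - exact: spectrum_closed.
  - by move=> z; apply: spectrum_bound.
have [l lP] : exists l, forall e : R, 0 < e -> exists N, forall n, (N <= n)%N ->
    nrm (l - peval a (P n)) < e.
  (* This sequence grows by [2 * 2^-n] at each step, while the increments of the values are at most
     [3/2 * 2^-n]. *)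
  apply: (@dominated_increments_cvg _ _ _ (fun n => - (4 * (2^-1) ^+ n)) 0) => n.
    by rewrite oppr_le0 mulr_ge0// exprn_ge0.
  have h0 : 0 <= (2^-1 : R) ^+ n by rewrite exprn_ge0.
  rewrite -pevalB exprS; apply: (@nrm_peval_le _ _ _ hA) => //; first by lra.
  move=> z sz; rewrite hornerD hornerN.
  have := PP n z sz; have := PP n.+1 z sz; rewrite exprS.
  have := nrm_triangle (f z) (P n.+1).[z] (P n).[z]; rewrite (nrmBC _ (f z)); lra.
exists l => e e0.
have [N NP] := lP _ e0.
have [k ke] : exists k : nat, (2^-1 : R) ^+ k <= e.
  have := near_infty_natSinv_expn_lt (PosNum e0) => -[k _ /(_ k (leqnn k))] /=.
  by rewrite div1r -exprVn => /ltW; exists k.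
exists (P (maxn N k)); split; last by apply/ltW/NP; rewrite leq_maxl.
move=> z sz; apply: le_trans (PP _ _ sz) _; apply: le_trans ke.
apply: ler_wiXn2l; rewrite ?leq_maxr//; lra.
Qed.

End Cfc.

(** * Existence and uniqueness of the calculus *)

Section CfcExists.
Context {R : realType} {B : cstarAlgType R}.
Variables (A : set B) (a : B).
Hypotheses (hA : sub_cstar A) (Aa : A a) (sa : star a = a).
Implicit Types (f g : R[i] -> R[i]) (c d : B) (p q : {poly R[i]}).

Lemma is_cfc_exists : exists Phi, is_cfc A a Phi.
Proof.
pose Phi f : B := xget 0 [set c | cfc_rel A a f c].
have PhiP f : {within spectrum A a, continuous f} -> cfc_rel A a f (Phi f).
  by move=> /(cfc_rel_exists _ _ hA Aa sa) h; apply: (xgetPex 0 h).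
have PhiE f c : cfc_rel A a f c -> Phi f = c.
  move=> fc; apply: (cfc_rel_uniq _ _ hA Aa sa f) => //.
  by apply: (xgetPex (0 : B) (P := [set c | cfc_rel A a f c])); exists c.
exists Phi; split.
- by move=> f /PhiP; apply: cfc_rel_in.
- apply: PhiE; have := cfc_rel_poly A a 'X; rewrite pevalX.
  by under eq_fun do rewrite hornerX.
- apply: PhiE; have := cfc_rel_poly A a 1; rewrite peval1.
  by under eq_fun do rewrite hornerC.
- by move=> f g /PhiP cf /PhiP cg; apply: PhiE; apply: cfc_relD.
- by move=> f g /PhiP cf /PhiP cg; apply: PhiE; apply: cfc_relM.
- by move=> c f /PhiP cf; apply: PhiE; apply: cfc_relZ.
- by move=> f /PhiP cf; apply: PhiE; apply: cfc_rel_star.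
move=> f M /PhiP cf M0.
have Mr : M = (complex.Re M)%:C by rewrite RRe_real// ger0_real.
have := cfc_rel_isometry _ _ hA Aa sa _ _ (complex.Re M) cf.
rewrite -ler0c -Mr => /(_ M0) [h1 h2]; split.
  by rewrite nrmE Mr lecR => /h1 h z /h; rewrite nrmE lecR.
move=> H; rewrite nrmE Mr lecR; apply: h2 => z /H.
by rewrite nrmE Mr lecR.
Qed.

Lemma is_cfc_poly Phi p : is_cfc A a Phi -> Phi (fun z => p.[z]) = peval a p.
Proof.
move=> hPhi; have h x : {within spectrum A a, continuous (fun z => x.[z])}.
  exact: within_horner.
elim/poly_ind: p => [|p c IH].
  have := cfcZ hPhi 0 (h 1); rewrite scale0r peval0 => <-.
  by congr Phi; apply/funext => z; rewrite horner0 mul0r.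
have -> : (fun z => (p * 'X + c%:P).[z]) =
    (fun z => (fun z => p.[z] * ('X).[z]) z + (fun z => c * (1 : {poly R[i]}).[z]) z).
  by apply/funext => z /=; rewrite hornerMXaddC hornerX hornerC mulr1.
have hM : {within spectrum A a, continuous (fun z => p.[z] * ('X).[z])}.
  by under eq_fun do rewrite -hornerM; apply: h.
have hZ : {within spectrum A a, continuous (fun z => c * (1 : {poly R[i]}).[z])}.
  by under eq_fun do rewrite -hornerZ; apply: h.
have PX : Phi (fun z => ('X).[z]) = a.
  by rewrite -[RHS](cfc_id hPhi); congr Phi; apply/funext => z; rewrite hornerX.
have P1 : Phi (fun z => (1 : {poly R[i]}).[z]) = 1.
  by rewrite -[RHS](cfc1 hPhi); congr Phi; apply/funext => z; rewrite hornerC.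
rewrite (cfcD hPhi hM hZ) (cfcM hPhi (h p) (h 'X)) (cfcZ hPhi _ (h 1)) IH PX P1.
by rewrite pevalD pevalMX pevalC.
Qed.

(** The axioms determine [Phi] on polynomials, and the isometry applied to [f - p] keeps [Phi f]
    close to [p(a)]. Hence [cfc] does not depend on the [Phi] selected. *)
Lemma is_cfc_rel Phi f : is_cfc A a Phi -> {within spectrum A a, continuous f} ->
  cfc_rel A a f (Phi f).
Proof.
move=> hPhi cf e e0; have [c /(_ e e0) [p [p1 _]]] := cfc_rel_exists _ _ hA Aa sa _ cf.
exists p; split=> //.
have cp : {within spectrum A a, continuous (fun z => p.[z])} by exact: within_horner.
have cNp : {within spectrum A a, continuous (fun z => -1 * p.[z])}.
  by under eq_fun do rewrite -hornerZ; apply: within_horner.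
have cfp : {within spectrum A a, continuous (fun z => f z + -1 * p.[z])}.
  apply/withinP => x Sx r r0; have r2 : 0 < r / 2 by lra.
  have [d1 d10 d1P] := iffLR (withinP _ _) cf x Sx _ r2.
  have [d2 d20 d2P] := iffLR (withinP _ _) cNp x Sx _ r2.
  exists (Num.min d1 d2); first by rewrite lt_min d10.
  move=> y Sy; rewrite lt_min => /andP[/(d1P _ Sy) h1 /(d2P _ Sy) h2].
  rewrite opprD addrACA; apply: le_lt_trans (nrmD _ _) _; lra.
have e0' : 0 <= e%:C :> R[i] by rewrite ler0c ltW.
have [_] := cfc_isometry hPhi cfp e0'.
rewrite (cfcD hPhi cf cNp) (cfcZ hPhi _ cp) is_cfc_poly// scaleN1r nrmE lecR.
by apply=> z sz; rewrite mulN1r nrmE lecR; apply: p1.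
Qed.

(** Existence rules out the default value of [xget], and [is_cfc_rel] handles whichever [Phi] it
    picks. *)
Lemma cfcP f : {within spectrum A a, continuous f} -> cfc_rel A a f (cfc A a f).
Proof.
move=> cf; rewrite /cfc; have [Phi hPhi] := is_cfc_exists.
have [Psi hPsi <-] := @xgetPex B 0 [set c | exists2 Phi, is_cfc A a Phi & Phi f = c]
  (ex_intro _ (Phi f) (ex_intro2 _ _ Phi hPhi erefl)).
exact: is_cfc_rel.
Qed.

Lemma within_real_cfc (phi : R -> R) : continuous phi ->
  {within spectrum A a, continuous (fun z => (phi (complex.Re z))%:C)}.
Proof.
move=> cphi; apply/withinP => x _ e e0.
have /cvgrPdist_lt /(_ _ e0) /nbhs_ballP [d /= d0 dP] := cphi (complex.Re x).
exists d => // y _ xy; rewrite -rmorphB nrm_real; apply: dP.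
by rewrite /ball /=; apply: le_lt_trans xy; rewrite -raddfB; apply: nrm_Re.
Qed.

Lemma real_cfc_in (phi : R -> R) : continuous phi -> A (real_cfc A a phi).
Proof. by move=> /within_real_cfc/cfcP; apply: cfc_rel_in. Qed.

(** Approximating on [[-M, M]] instead of the spectrum lets one polynomial serve several elements
    and several subalgebras. *)
Lemma real_cfc_approx (phi : R -> R) (p : {poly R}) (M e : R) :
  continuous phi -> nrm a <= M -> 0 <= e ->
  (forall t, `|t| <= M -> `|phi t - p.[t]| <= e) ->
  nrm (real_cfc A a phi - peval a (rpoly p)) <= e.
Proof.
move=> /within_real_cfc/cfcP fc aM e0 H.
have := cfc_relZ A a (-1) _ _ (cfc_rel_poly A a (rpoly p)).
move=> /(cfc_relD _ _ _ _ _ _ fc); rewrite scaleN1r.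
move=> /(cfc_rel_isometry _ _ hA Aa sa _ _ e)/(_ e0) [_]; apply=> z sz.
have zr := spectrum_real _ hA _ _ Aa sa sz.
rewrite {2}zr horner_rpoly mulN1r -rmorphB nrm_real; apply: H.
rewrite -nrm_real -zr; apply: le_trans aM; exact: spectrum_bound sz.
Qed.

Lemma nrm_rpoly_le (p : {poly R}) (M e : R) : nrm a <= M -> 0 <= e ->
  (forall t, `|t| <= M -> `|p.[t]| <= e) -> nrm (peval a (rpoly p)) <= e.
Proof.
move=> aM e0 H; apply: (@nrm_peval_le _ _ _ hA) => // z sz.
have zr := spectrum_real _ hA _ _ Aa sa sz.
rewrite zr horner_rpoly nrm_real; apply: H.
rewrite -nrm_real -zr; apply: le_trans aM; exact: spectrum_bound sz.
Qed.

End CfcExists.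

(** * Ideals and the sum A + K *)

Section Ideals.
Context {R : realType} {B : cstarAlgType R}.
Variable K : set B.
Hypothesis hK : closed_ideal K.
Implicit Types (a k x y : B) (c : R[i]) (p : {poly R[i]}).

(** Makes the spectral norm bounds available for any selfadjoint element of [B]. *)
Lemma sub_cstarT : sub_cstar (@setT B).
Proof. by split=> //; exact: closedT. Qed.

Lemma idealZ c x : K x -> K (c *: x).
Proof. by move=> Kx; rewrite -[x]mul1r cscalerAl; apply: closed_idealMl. Qed.

Lemma idealN x : K x -> K (- x).
Proof. by rewrite -scaleN1r; apply: idealZ. Qed.

Lemma idealB x y : K x -> K y -> K (x - y).
Proof. by move=> Kx /idealN; apply: closed_idealD. Qed.

(** Equality modulo a two-sided ideal is preserved by each Horner step. *)
Lemma ideal_peval a k p : K k -> K (peval (a + k) p - peval a p).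
Proof.
move=> Kk; elim/poly_ind: p => [|p c IH].
  by rewrite !peval0 subrr; apply: closed_ideal0.
rewrite !pevalD !pevalMX !pevalC opprD addrACA subrr addr0.
have -> : peval (a + k) p * (a + k) - peval a p * a =
    (peval (a + k) p - peval a p) * (a + k) + peval a p * k.
  by rewrite mulrBl -addrA; congr (_ + _); rewrite mulrDr opprD addrNK.
by apply: closed_idealD => //; [apply: closed_idealMr|apply: closed_idealMl].
Qed.

(** Follows from Bernoulli's inequality in the form [(1 - u)^n * (1 + n * u) <= 1]. *)
Lemma bernoulli_decay (u : R) n : 0 <= u <= 1 -> u * (1 - u) ^+ n * n%:R <= 1.
Proof.
move=> /andP[u0 u1].
have h : (1 - u) ^+ n * (1 + n%:R * u) <= 1.
  elim: n => [|n IH]; first by rewrite expr0 mul0r addr0 mul1r.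
  apply: le_trans IH; rewrite exprSr -mulrA ler_wpM2l ?exprn_ge0 ?subr_ge0//.
  rewrite -natr1; have := ler0n R n; nra.
have : 0 <= (1 - u) ^+ n by rewrite exprn_ge0 ?subr_ge0.
nra.
Qed.

(* An approximate unit 1 - q(x) of K, for x selfadjoint in K. *)
Lemma approximate_unit_poly (N e : R) : 0 < N -> 0 < e ->
  exists2 q : {poly R}, q.[0] = 1 & forall t, `|t| <= N -> `|(q * 'X * q).[t]| <= e.
Proof.
move=> N0 e0; have [n nP] : exists n : nat, N ^+ 2 <= e ^+ 2 * n%:R.
  exists (Num.truncn (N ^+ 2 / e ^+ 2)).+1.
  by rewrite mulrC -ler_pdivrMr ?exprn_gt0//; exact/ltW/truncnS_gt.
have bE s : (1 - (N ^- 2)%:P * 'X ^+ 2 : {poly R}).[s] = 1 - s ^+ 2 / N ^+ 2.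
  by rewrite hornerD hornerN hornerM !hornerC hornerXn mulrC.
(* With [u = t^2 / N^2], the square of [q * 'X * q] at [t] is [N^2 * u * (1 - u)^(4 n)], at most
   [N^2 / (4 n)]. *)
exists ((1 - (N ^- 2)%:P * 'X ^+ 2) ^+ n).
  by rewrite horner_exp bE expr0n mul0r subr0 expr1n.
move=> t tN; set u := t ^+ 2 / N ^+ 2.
have N20 : 0 < N ^+ 2 by rewrite exprn_gt0.
have u01 : 0 <= u <= 1.
  rewrite divr_ge0 ?sqr_ge0//= ler_pdivrMr// mul1r -real_normK ?num_real//.
  by rewrite ler_sqr ?nnegrE// ltW.
have -> : ((1 - (N ^- 2)%:P * 'X ^+ 2) ^+ n * 'X * (1 - (N ^- 2)%:P * 'X ^+ 2) ^+ n).[t]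
    = t * (1 - u) ^+ (n * 2).
  by rewrite !hornerM horner_exp bE hornerX exprM expr2 -/u mulrC mulrA mulrC.
have u4 := @bernoulli_decay u (n * 4) u01.
rewrite -ler_sqr ?nnegrE ?(ltW e0)// real_normK ?num_real// exprMn -exprM -mulnA.
have tE : t ^+ 2 = N ^+ 2 * u by rewrite /u mulrC divfK ?gt_eqF.
have w0 : 0 <= u * (1 - u) ^+ (n * 4).
  by case/andP: u01 => *; rewrite mulr_ge0// exprn_ge0// subr_ge0.
rewrite tE -mulrA; move: w0 u4; rewrite natrM; set w := u * _ => w0 u4.
have := ler0n R n; have := sqr_ge0 e.
move: nP; move: (N ^+ 2) N20 (e ^+ 2) n%:R u4 => NN N20 E m u4 nP E0 m0.
apply: le_trans (ler_wpM2r w0 nP) _; nra.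
Qed.

(** With [x = k * star k] and [g = q(x)], the element [star k * (1 - g)] of [K] differs from
    [star k] by [star k * g], whose squared norm is [|g * x * g|], small by the choice of [q]. *)
Lemma ideal_star k : K k -> K (star k).
Proof.
move=> Kk; apply: (iffLR (closedP _) (closed_ideal_closed hK)) => e e0.
set x := k * star k.
have Kx : K x by apply: closed_idealMr.
have sx : star x = x by rewrite /x star_mul starK.
have N0 : 0 < nrm x + 1 by rewrite ltr_wpDl ?nrm_ge0.
have e20 : 0 < (e / 2) ^+ 2 by rewrite exprn_gt0//; lra.
have [q q0 qP] := approximate_unit_poly _ _ N0 e20.
set g := peval x (rpoly q).
(* Since [q(0) = 1], this is [ideal_peval] for the perturbation of [0] by [x]. *)
have Kg : K (1 - g).
  have := ideal_peval 0 _ (rpoly q) Kx; rewrite add0r -/g => /idealN; rewrite opprB.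
  suff -> : peval 0 (rpoly q) = 1 :> B by [].
  rewrite (peval_wide (size (rpoly q)).+1)// big_ord_recl big1 ?addr0.
    rewrite -horner_coef0 -(rmorph0 (real_complex R)) horner_rpoly q0.
    by rewrite rmorph1 scale1r.
  by move=> i _; rewrite expr0n /= scaler0.
exists (star k * (1 - g)); first exact: closed_idealMl.
rewrite mulrBr mulr1 subKr.
suff : nrm (star k * g) <= e / 2 by lra.
rewrite -ler_sqr ?nnegrE ?nrm_ge0//; last lra.
have sg : star g = g by apply: star_rpoly.
rewrite -nrm_starM star_mul starK sg mulrA -(mulrA g) -/x.
have -> : g * x * g = peval x (rpoly (q * 'X * q)).
  by rewrite /rpoly !rmorphM /= map_polyX !pevalM pevalX.
apply: (nrm_rpoly_le _ _ sub_cstarT _ sx _ (nrm x + 1)) => //; last exact: ltW.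
by rewrite lerDl.
Qed.

End Ideals.

(** * Closedness of [A + K] *)

Section SumClosed.
Context {R : realType} {B : cstarAlgType R}.
Variables (A K : set B).
Hypotheses (hA : sub_cstar A) (hK : closed_ideal K).
Implicit Types (a k x y : B).

Let AZ c x : A x -> A (c *: x). Proof. exact: sub_cstarZ. Qed.
Let AD x y : A x -> A y -> A (x + y). Proof. exact: sub_cstarD. Qed.
Let AB x y : A x -> A y -> A (x - y).
Proof. by move=> Ax Ay; rewrite -scaleN1r; apply: AD => //; apply: AZ. Qed.

Lemma lift_selfadj a k (d : R) : A a -> star a = a -> K k -> star k = k ->
  nrm (a + k) <= d -> exists j, [/\ A j, K j & nrm (a - j) <= d].
Proof.
move=> Aa sa Kk sk akd.
have d0 : 0 <= d by apply: le_trans akd; exact: nrm_ge0.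
(* Truncation to [[-d, d]], written with absolute values to make its continuity immediate. *)
pose clip (t : R) := (`|t + d| - `|t - d|) / 2.
pose g t := t - clip t.
have clipd t : `|clip t| <= d.
  rewrite normrM (@ger0_norm _ 2^-1) ?invr_ge0// ler_pdivrMr//.
  apply: le_trans (ler_dist_dist _ _) _.
  have -> : t + d - (t - d) = d * 2 by ring.
  by rewrite ger0_norm ?mulr_ge0.
have gd t : `|t| <= d -> g t = 0.
  rewrite ler_norml => /andP[h1 h2]; rewrite /g /clip ger0_norm; last by lra.
  by rewrite ler0_norm; lra.
have cg : continuous g.
  move=> t; apply: cvgB; first exact: cvg_id.
  apply: cvgM; last exact: cvg_cst.
  by apply: cvgB; apply: cvg_norm; [apply: cvgD|apply: cvgB];
    [exact: cvg_id|exact: cvg_cst|exact: cvg_id|exact: cvg_cst].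
set M := nrm a + d.
have aM : nrm a <= M by rewrite lerDl.
have dM : d <= M by rewrite lerDr nrm_ge0.
have sak : star (a + k) = a + k by rewrite starD sa sk.
exists (real_cfc A a g); split; first exact: real_cfc_in.
  apply: (iffLR (closedP _) (closed_ideal_closed hK)) => e e0.
  have e3 : 0 < e / 3 by lra.
  have [p pP] := weierstrass _ g M _ e3 cg.
  (* As [g] vanishes on [[-d, d]], which bounds the spectrum of [a + k], the term [p(a + k)] is
     small and this element of [K] is close to [g(a)]. *)
  exists (- (peval (a + k) (rpoly p) - peval a (rpoly p))).
    by apply: idealN => //; apply: ideal_peval.
  have h1 := real_cfc_approx _ _ hA Aa sa _ _ _ _ cg aM (ltW e3) pP.
  have h2 : nrm (peval (a + k) (rpoly p)) <= e / 3.
    apply: (nrm_rpoly_le _ _ sub_cstarT _ sak _ d) => //; first exact: ltW.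
    by move=> t td; have := pP t (le_trans td dM); rewrite gd// sub0r normrN.
  rewrite opprB opprB addrCA addrC.
  apply: le_lt_trans (nrmD _ _) _; lra.
apply/ler_addgt0Pr => e e0; have e2 : 0 < e / 2 by lra.
have [p pP] := weierstrass _ g M _ e2 cg.
have h1 := real_cfc_approx _ _ hA Aa sa _ _ _ _ cg aM (ltW e2) pP.
(* Up to the approximation error, ['X - p] is [clip], which is bounded by [d]. *)
have h2 : nrm (peval a (rpoly ('X - p))) <= d + e / 2.
  apply: (nrm_rpoly_le _ _ sub_cstarT _ sa _ M) => //; first by lra.
  move=> t tM; rewrite hornerD hornerN hornerX.
  have -> : t - p.[t] = clip t + (g t - p.[t]) by rewrite /g; ring.
  by apply: le_trans (ler_normD _ _) _; rewrite lerD// pP.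
move: h2; rewrite /rpoly rmorphB /= map_polyX pevalB pevalX -/(rpoly p) => h2.
apply: le_trans (nrm_triangle (peval a (rpoly p)) _ _) _.
by rewrite (nrmBC (peval _ _)); lra.
Qed.

Definition repart x : B := (2^-1)%:C *: (x + star x).
Definition impart x : B := (2^-1)%:C *: ((- 'i) *: (x - star x)).

Lemma repart_selfadj x : star (repart x) = repart x.
Proof. by rewrite starZr starD starK addrC. Qed.

Lemma conjc_Ni : conjc (- 'i) = 'i :> R[i].
Proof. by apply/eqP; rewrite eq_complex /= opprK oppr0 !eqxx. Qed.

Lemma impart_selfadj x : star (impart x) = impart x.
Proof.
by rewrite starZr starZc conjc_Ni starB starK -opprB scalerN -scaleNr.
Qed.

Lemma repartE x : star x = x -> repart x = x.
Proof. by move=> sx; rewrite /repart sx half_addxx. Qed.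

Lemma repart_impart x : x = repart x + 'i *: impart x.
Proof.
have ii : 'i * - 'i = 1 :> R[i] by rewrite mulrN -expr2 sqr_i opprK.
rewrite /repart /impart scalerA mulrC -scalerA (scalerA 'i) ii scale1r.
by rewrite -scalerDr addrACA subrr addr0 half_addxx.
Qed.

Lemma repartD x y : repart (x + y) = repart x + repart y.
Proof. by rewrite /repart starD addrACA scalerDr. Qed.

Lemma impartD x y : impart (x + y) = impart x + impart y.
Proof. by rewrite /impart starD opprD addrACA !scalerDr. Qed.

Lemma nrm_repart x : nrm (repart x) <= nrm x.
Proof.
rewrite nrmZr ger0_norm; last by lra.
have := nrmD x (star x); rewrite nrm_star; lra.
Qed.

Lemma nrm_i : nrm ('i : R[i]) = 1.
Proof. by rewrite /nrm normc_def /= expr0n expr1n add0r sqrtr1. Qed.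

Lemma nrm_impart x : nrm (impart x) <= nrm x.
Proof.
rewrite nrmZr nrmZ nrmN nrm_i mul1r ger0_norm; last by lra.
have := nrmB x (star x); rewrite nrm_star; lra.
Qed.

Lemma repart_in x : A x -> A (repart x).
Proof. by move=> Ax; apply: AZ; apply: AD => //; apply: sub_cstar_star. Qed.

Lemma impart_in x : A x -> A (impart x).
Proof. by move=> Ax; apply: AZ; apply: AZ; apply: AB => //; apply: sub_cstar_star. Qed.

Lemma repart_ideal x : K x -> K (repart x).
Proof.
by move=> Kx; apply: idealZ => //; apply: closed_idealD => //; apply: ideal_star.
Qed.

Lemma impart_ideal x : K x -> K (impart x).
Proof.
move=> Kx; apply: idealZ => //; apply: idealZ => //; apply: idealB => //.
exact: ideal_star.
Qed.

(** Taking real or imaginary parts does not increase the norm, so [lift_selfadj] applies to each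
    with the same [d]; recombining them costs the factor 2. *)
Lemma lift_sum a k (d : R) : A a -> K k -> nrm (a + k) <= d ->
  exists j, [/\ A j, K j & nrm (a - j) <= 2 * d].
Proof.
move=> Aa Kk akd.
have [j1 [Aj1 Kj1 j1d]] := lift_selfadj _ _ d (repart_in _ Aa) (repart_selfadj a)
  (repart_ideal _ Kk) (repart_selfadj k) ltac:(by rewrite -repartD (le_trans (nrm_repart _))).
have [j2 [Aj2 Kj2 j2d]] := lift_selfadj _ _ d (impart_in _ Aa) (impart_selfadj a)
  (impart_ideal _ Kk) (impart_selfadj k) ltac:(by rewrite -impartD (le_trans (nrm_impart _))).
exists (j1 + 'i *: j2); split.
- by apply: AD => //; apply: AZ.
- by apply: closed_idealD => //; apply: idealZ.
rewrite [a in a - _]repart_impart opprD addrACA -scalerBr.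
apply: le_trans (nrmD _ _) _; rewrite nrmZ nrm_i; lra.
Qed.

(** If [a_n + k_n] tends to [x] fast, corrections [j_n] in [A] and [K] turn [a_n] into a convergent
    [b_n] congruent to it modulo [K]. Then [l = lim b_n] is in [A], and [x - l] is the limit of
    [k_n + (a_n - b_n)] in [K]. *)
Lemma set_add_closed : closed (set_add A K).
Proof.
apply/closedP => x H.
have r0 n : 0 < (2^-1 : R) ^+ n by rewrite exprn_gt0// invr_gt0.
have [|u uP] := @choice nat (B * B) (fun n ak => [/\ A ak.1, K ak.2 &
    nrm (x - (ak.1 + ak.2)) <= (2^-1) ^+ n]).
  move=> n; have [_ [a Aa [k Kk <-]] h] := H _ (r0 n).
  by exists (a, k); split=> //; apply: ltW.
(* Consecutive approximants differ by at most [2 * 2^-n]; [lift_sum] doubles this. *)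
have [|j jP] := @choice nat B (fun n j => [/\ A j, K j &
    nrm ((u n.+1).1 - (u n).1 - j) <= 2 * (2 * (2^-1) ^+ n)]).
  move=> n; have [a1 k1 h1] := uP n; have [a2 k2 h2] := uP n.+1.
  apply: (@lift_sum _ ((u n.+1).2 - (u n).2)); [exact: AB|exact: idealB|].
  rewrite addrACA -opprD; apply: le_trans (nrm_triangle x _ _) _.
  move: h2; rewrite nrmBC exprS; have := r0 n; lra.
pose b := fix b n := if n is n'.+1 then b n' + ((u n'.+1).1 - (u n').1 - j n')
  else (u 0%N).1.
have Ab n : A (b n).
  elim: n => [|n IH] /=; first by have [] := uP 0%N.
  have [a1 _ _] := uP n; have [a2 _ _] := uP n.+1; have [j1 _ _] := jP n.
  by apply: AD => //; apply: AB => //; apply: AB.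
have Kb n : K ((u n).1 - b n).
  elim: n => [|n IH] /=; first by rewrite subrr; apply: closed_ideal0.
  have [_ j1 _] := jP n.
  suff -> : (u n.+1).1 - (b n + ((u n.+1).1 - (u n).1 - j n)) = (u n).1 - b n + j n.
    exact: closed_idealD.
  by rewrite !opprD !opprK addrCA !addrA addrK [- b n + _]addrC.
have [l lP] : exists l, forall e : R, 0 < e -> exists N, forall n, (N <= n)%N ->
    nrm (l - b n) < e.
  (* The growth of this sequence is [4 * 2^-n], exactly the bound on the corrected increments. *)
  apply: (@dominated_increments_cvg _ _ _ (fun n => - (8 * (2^-1) ^+ n)) 0) => n.
    by rewrite oppr_le0 mulr_ge0// ltW.
  have [_ _ h] := jP n; rewrite [b n.+1]/= addrC addKr exprS; lra.
have Al : A l.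
  apply: (iffLR (closedP _) (sub_cstar_closed hA)) => e /lP [N /(_ N (leqnn N)) h].
  by exists (b N).
exists l => //; exists (x - l); last by rewrite addrC subrK.
apply: (iffLR (closedP _) (closed_ideal_closed hK)) => e e0.
have e2 : 0 < e / 2 by lra.
have [N1 N1P] := lP _ e2.
have [N2 _ N2P] := near_infty_natSinv_expn_lt (PosNum e2).
set n := maxn N1 N2.
have [_ kn h] := uP n.
exists ((u n).2 + ((u n).1 - b n)); first exact: closed_idealD.
have -> : x - l - ((u n).2 + ((u n).1 - b n)) =
    (x - ((u n).1 + (u n).2)) - (l - b n).
  by rewrite addrA [(u n).2 + _]addrC !opprB [b n - (_ + _)]addrC addrACA [- l + _]addrC.
apply: le_lt_trans (nrmB _ _) _.
have := N1P n (leq_maxl _ _).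
have := N2P n (leq_maxr _ _); rewrite /= div1r -exprVn; lra.
Qed.

Lemma sub_cstar_add : sub_cstar (set_add A K).
Proof.
split.
- exact: set_add_closed.
- by exists 1; [exact: sub_cstar1|exists 0; [exact: closed_ideal0|rewrite addr0]].
- move=> _ _ [a Aa [k Kk <-]] [b Ab [l Kl <-]]; exists (a + b); first exact: AD.
  by exists (k + l); [apply: closed_idealD|rewrite addrACA].
- move=> _ _ [a Aa [k Kk <-]] [b Ab [l Kl <-]].
  exists (a * b); first exact: sub_cstarM.
  exists (a * l + k * (b + l)); last by rewrite addrA -mulrDr -mulrDl.
  by apply: closed_idealD => //; [apply: closed_idealMl|apply: closed_idealMr].
- move=> c _ [a Aa [k Kk <-]]; exists (c *: a); first exact: AZ.
  by exists (c *: k); [apply: idealZ|rewrite scalerDr].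
move=> _ [a Aa [k Kk <-]]; exists (star a); first exact: sub_cstar_star.
by exists (star k); [apply: ideal_star|rewrite starD].
Qed.

End SumClosed.

(** * The isocone of A + K *)

Section Perturbation.
Context {R : realType} {B : cstarAlgType R}.
Variables (A I K : set B).
Hypotheses (hA : sub_cstar A) (hI : isocone A I) (hK : closed_ideal K).

Let hAK := sub_cstar_add A K hA hK.

Lemma closure_add_selfadj x : closure (set_add I (selfadj K)) x ->
  selfadj (set_add A K) x.
Proof.
move=> /closureP H.
have sub y : set_add I (selfadj K) y -> set_add A K y /\ star y = y.
  move=> [i Ii [k [Kk sk] <-]]; have [Ai si] := isocone_selfadj hI Ii.
  by split; [exists i => //; exists k|rewrite starD si sk].
split.
  apply: (iffLR (closedP _) (sub_cstar_closed hAK)) => e /H [y /sub [Ay _] xy].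
  by exists y.
by apply: star_lim => e /H [y /sub [_ sy] xy]; exists y.
Qed.

(** The chain is [phi(b)], [p(b)], [p(i + k)], [phi(i + k)], [q(i + k) = q(i) + l], [phi(i) + l],
    with five errors of at most [e / 6]. Polynomials link the calculi in [A + K] and in [A]. *)
Lemma real_cfc_add_ideal (phi : R -> R) b : continuous phi ->
  {homo phi : x y / x <= y} -> closure (set_add I (selfadj K)) b ->
  closure (set_add I (selfadj K)) (real_cfc (set_add A K) b phi).
Proof.
move=> cphi hphi Jb; have [AKb sb] := closure_add_selfadj _ Jb.
apply/closureP => e e0; have e6 : 0 < e / 6 by lra.
pose M := nrm b + 1.
have [p pP] := weierstrass _ phi M _ e6 cphi.
have [d d0 dP] := peval_continuous b (rpoly p) _ e6.
have [|y Jy] := iffLR (closureP _ _) Jb (Num.min 1 d); first by rewrite lt_min ltr01.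
rewrite lt_min => /andP[by1 /dP byp].
have bM : nrm b <= M by rewrite lerDl.
have yM : nrm y <= M by have := nrmB b (b - y); rewrite subKr /M; lra.
move: Jy byp yM {by1}; move=> [i Ii [k [Kk sk] <-]] byp yM.
have [Ai si] := isocone_selfadj hI Ii.
have sik : star (i + k) = i + k by rewrite starD si sk.
have AKik : set_add A K (i + k) by exists i => //; exists k.
(* The norm of [i] is not controlled by that of [b], and [i] is chosen after [p]; hence a second
   polynomial [q] on a larger interval. *)
pose N := Num.max M (nrm i).
have MN : M <= N by rewrite le_max lexx.
have iN : nrm i <= N by rewrite le_max lexx orbT.
have [q qP] := weierstrass _ phi N _ e6 cphi.
set l := peval (i + k) (rpoly q) - peval i (rpoly q).
exists (real_cfc A i phi + l).
  exists (real_cfc A i phi); first exact: (isocone_cfc hI).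
  exists l => //; split; first exact: ideal_peval.
  by rewrite starB !star_rpoly.
have h1 := real_cfc_approx _ _ hAK AKb sb _ _ _ _ cphi bM (ltW e6) pP.
have h2 := real_cfc_approx _ _ hAK AKik sik _ _ _ _ cphi yM (ltW e6) pP.
have h3 := real_cfc_approx _ _ hAK AKik sik _ _ _ _ cphi (le_trans yM MN) (ltW e6) qP.
have h4 := real_cfc_approx _ _ hA Ai si _ _ _ _ cphi iN (ltW e6) qP.
have -> : real_cfc (set_add A K) b phi - (real_cfc A i phi + l) =
    (real_cfc (set_add A K) b phi - peval (i + k) (rpoly q)) -
    (real_cfc A i phi - peval i (rpoly q)).
  by rewrite /l [real_cfc A i phi + _]addrCA opprD addrA.
apply: le_lt_trans (nrmB _ _) _.
have t1 := nrm_triangle (peval b (rpoly p)) (real_cfc (set_add A K) b phi)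
  (peval (i + k) (rpoly q)).
have t2 := nrm_triangle (peval (i + k) (rpoly p)) (peval b (rpoly p))
  (peval (i + k) (rpoly q)).
have t3 := nrm_triangle (real_cfc (set_add A K) (i + k) phi)
  (peval (i + k) (rpoly p)) (peval (i + k) (rpoly q)).
move: t3; rewrite (nrmBC (peval (i + k) (rpoly p)) (real_cfc _ _ _)) => t3.
lra.
Qed.

Lemma isocone_add : isocone (set_add A K) (closure (set_add I (selfadj K))).
Proof.
have K0 : selfadj K 0 by split; [exact: closed_ideal0|rewrite star0].
have JI i : I i -> closure (set_add I (selfadj K)) i.
  by move=> Ii; apply: subset_closure; exists i => //; exists 0; rewrite ?addr0.
split.
- exact: closure_add_selfadj.
- by move=> r; apply: JI; apply: (isocone_cst hI).
- move=> b c /closureP Jb /closureP Jc; apply/closureP => e e0.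
  have e2 : 0 < e / 2 by lra.
  have [_ [i Ii [k [Kk sk] <-]] h1] := Jb _ e2.
  have [_ [j Ij [l [Kl sl] <-]] h2] := Jc _ e2.
  exists (i + k + (j + l)).
    exists (i + j); first exact: (isoconeD hI).
    exists (k + l); last by rewrite addrACA.
    by split; [apply: closed_idealD|rewrite starD sk sl].
  rewrite opprD addrACA; apply: le_lt_trans (nrmD _ _) _; lra.
- by move=> phi b; apply: real_cfc_add_ideal.
- exact: closed_closure.
apply/seteqP; split=> x.
  move=> /closureP H; split.
    apply: (iffLR (closedP _) (sub_cstar_closed hAK)) => e /H.
    move=> [_ [y /closure_add_selfadj [Ay _] [z /closure_add_selfadj [Az _] <-]] xyz].
    exists (y - z) => //; rewrite -scaleN1r.
    by apply: sub_cstarD => //; apply: sub_cstarZ.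
  apply: star_lim => e /H.
  move=> [_ [y /closure_add_selfadj [_ sy] [z /closure_add_selfadj [_ sz] <-]] xyz].
  by exists (y - z) => //; rewrite starB sy sz.
move=> [[a Aa [k Kk akx]] sx]; apply/closureP => e e0.
(* A selfadjoint [x = a + k] equals [repart a + repart k]: approximate the first term by [i - j] and
   absorb the second into [i]. *)
have : closure (set_sub I I) (repart a).
  rewrite (isocone_dense hI); split; last exact: repart_selfadj.
  exact: repart_in.
move=> /closureP/(_ e e0) [_ [i Ii [j Ij <-]] h].
have Kr : selfadj K (repart k).
  by split; [apply: repart_ideal|apply: repart_selfadj].
exists (i + repart k - j).
  exists (i + repart k); last by exists j => //; apply: JI.
  by apply: subset_closure; exists i => //; exists (repart k).
by rewrite -(repartE x sx) -akx repartD [i + _ - j]addrAC opprD addrACA subrr addr0.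
Qed.

End Perturbation.

Theorem corollary1 (R : realType) (B : cstarAlgType R) (A I K : set B)
    (hA : sub_cstar A) (hI : isocone A I) (hK : closed_ideal K) :
  sub_cstar (set_add A K) /\
  isocone (set_add A K) (closure (set_add I (selfadj K))).
Proof. by split; [apply: sub_cstar_add|apply: isocone_add]. Qed.
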